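(* Let $S$ be a Damek--Ricci space, let $k\ge1$ be an integer and let $J\in\{0,\dots,n-1\}^k$. Then (with identities holding on $S\setminus\{e\}$ for all $t>0$): i) $|\Upsilon_{2j+1,J}|\lesssim r^{-k+2j+1}$ for $r\le1$ and $j=0,\dots,\big[\tfrac{k-1}2\big]$; ii) if $k$ is odd, then $$\mathbb{X}_Jh_t=\sum_{j=0}^{(k-1)/2}\Phi_{k-2j-1,2j,t}\,\Upsilon_{2j+1,J}+\sum_{j=1}^{(k-1)/2}h_t^{(2j)}\,\Xi_{2j,J};$$ iii) if $k$ is even, then $$\mathbb{X}_Jh_t=\sum_{j=0}^{k/2-1}\Phi_{k-2j-2,2j,t}\,\Upsilon_{2j+1,J}+\sum_{j=1}^{k/2-1}h_t^{(2j)}\,\Xi_{2j,J}+h_t^{(k)}\,\sigma_{k,J}.$$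
   Context: Damek--Ricci space. Let $\nu\ge1$ and $\mu\ge0$ be integers and let $z\mapsto J_z$ be a linear map from $\mathbb{R}^\nu$ to skew-symmetric $\mu\times\mu$ real matrices such that $J_z$ is orthogonal whenever $|z|=1$ (so $\mu$ is even; the degenerate case $\mu=0$, where the variable $x$ is absent, is allowed). Let $(e_\ell)$, $(u_k)$ be the standard bases of $\mathbb{R}^\mu$, $\mathbb{R}^\nu$. $S=\mathbb{R}^\mu\times\mathbb{R}^\nu\times\mathbb{R}^+$ is the group with law $(x,z,a)(x',z',a')=\big(x+\sqrt a\,x',\,z+az'+\tfrac12\sqrt a\sum_{k=1}^\nu(J_{u_k}x,x')u_k,\,aa'\big)$ and identity $e=(0,0,1)$. Set $Q=(\mu+2\nu)/2$ and $n=\mu+\nu+1=\dim S$. Left-invariant vector fields: $\mathbb{X}_0=a\partial_a$, $\mathbb{X}_\ell=\sqrt a\big(\partial_{x_\ell}+\tfrac12\sum_{k=1}^\nu(J_{u_k}x,e_\ell)\partial_{z_k}\big)$ for $1\le\ell\le\mu$, $\mathbb{X}_{\mu+k}=a\,\partial_{z_k}$ for $1\le k\le\nu$. $S$ carries the left-invariant Riemannian metric for which $\mathbb{X}_0,\dots,\mathbb{X}_{n-1}$ are orthonormal; $d$ is the Riemannian distance and $r(\underline{x})=d(\underline{x},e)$. The left Haar measure is $d\lambda=a^{-Q-1}\,dx\,dz\,da$. For $J=(J_1,\dots,J_k)\in\{0,\dots,n-1\}^k$, $\mathbb{X}_J=\mathbb{X}_{J_1}\cdots\mathbb{X}_{J_k}$.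 Heat kernel. $\mathcal{L}=-\sum_{j=0}^{n-1}\mathbb{X}_j^2+Q\mathbb{X}_0$ is the (non-negative) Laplace--Beltrami operator, essentially self-adjoint on $L^2(\lambda)$; $h_t$ is the right-convolution kernel of $e^{-t\mathcal{L}}$ (i.e. $e^{-t\mathcal{L}}f=f*h_t$, $f*g(\underline{x})=\int_S f(y)g(y^{-1}\underline{x})\,d\lambda(y)$). It is smooth and radial, $h_t(\underline{x})=h_t(r(\underline{x}))$, and $h_t^{(j)}$ is the $j$-th derivative in $r$ of $h_t(r)$ (evaluated at $r=r(\underline{x})$). Auxiliary functions. For $J\in\{0,\dots,n-1\}^k$, $\sigma_{1,J},\dots,\sigma_{k,J}$ are the functions on $S\setminus\{e\}$ such that $\mathbb{X}_Jg=\sum_{j=1}^kg^{(j)}(r)\,\sigma_{j,J}$ for every smooth radial function $g$ on $S$ ($g^{(j)}$ is the $j$-th radial derivative). For integers $b,q\ge0$: $\Phi_{0,2q,t}=h_t^{(2q+1)}$, and for $b\ge1$, $\Phi_{2b,2q,t}(r)=\sum_{\ell=0}^{2b-1}\frac{(-1)^\ell r^\ell}{\ell!}h_t^{(2q+\ell+1)}(r)$. Define recursively $\Upsilon_{2j+1,J}=\sigma_{2j+1,J}-\sum_{\ell=0}^{j-1}\frac{r^{2j-2\ell}}{(2j-2\ell)!}\Upsilon_{2\ell+1,J}$ for $j=0,\dots,\big[\tfrac{k-1}2\big]-1$, together with $\Upsilon_{k-1,J}=\sigma_{k-1,J}$ if $k$ is even and $\Upsilon_{k,J}=\sigma_{k,J}$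 if $k$ is odd. Define $\Xi_{2j,J}=\sigma_{2j,J}+\sum_{\ell=0}^{j-1}\frac{r^{2j-2\ell-1}}{(2j-2\ell-1)!}\Upsilon_{2\ell+1,J}$ for $j=1,\dots,\big[\tfrac{k-1}2\big]$. Here $[\cdot]$ is the integer part and empty sums are zero. $v\lesssim w$ means $v\le Cw$ with $C$ depending only on $S$ and $k$. *)

(* Defs.v *)
From HB Require Import structures.
From mathcomp Require Import all_boot all_order all_algebra.
From mathcomp Require Import all_classical all_reals all_analysis.
From mathcomp Require Import measurable_realfun.

Set Implicit Arguments.
Unset Strict Implicit.
Unset Printing Implicit Defensive.

Import Order.TTheory GRing.Theory Num.Theory.
Import numFieldNormedType.Exports.

Local Open Scope classical_set_scope.
Local Open Scope ring_scope.

Section rV_measurable.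
Context d (T : sigmaRingType d) (n : nat).

Definition rV_coord (i : 'I_n) (v : 'rV[T]_n) : T := v ord0 i.

Let rV_set0 : g_sigma_preimage rV_coord set0.
Proof. exact: sigma_algebra0. Qed.

Let rV_setC A : g_sigma_preimage rV_coord A -> g_sigma_preimage rV_coord (~` A).
Proof. exact: sigma_algebraC. Qed.

Let rV_bigcup (F : _^nat) : (forall i, g_sigma_preimage rV_coord (F i)) ->
  g_sigma_preimage rV_coord (\bigcup_i (F i)).
Proof. exact: sigma_algebra_bigcup. Qed.

HB.instance Definition _ := @isMeasurable.Build (measure_tuple_display d)
  'rV[T]_n (g_sigma_preimage rV_coord) rV_set0 rV_setC rV_bigcup.

End rV_measurable.

Lemma measurable_rV_coord d (T : sigmaRingType d) n (i : 'I_n) :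
  measurable_fun [set: 'rV[T]_n] (@rV_coord _ T n i).
Proof.
move=> _ Y mY; rewrite setTI; apply: sub_sigma_algebra => /=.
rewrite -bigcup_seq/=; exists i => /=; first by rewrite mem_index_enum.
by exists Y => //; rewrite setTI.
Qed.

Lemma measurable_fun_rVP d1 d2 (T1 : measurableType d1) (T2 : measurableType d2)
    n (f : T1 -> 'rV[T2]_n) :
  (forall i, measurable_fun [set: T1] (@rV_coord _ T2 n i \o f)) ->
  measurable_fun [set: T1] f.
Proof.
move=> mf.
suff prefS : g_sigma_preimage (fun i => @rV_coord _ T2 n i \o f) `<=` measurable.
  move=> _ A mA; apply: prefS.
  by rewrite g_sigma_preimage_comp; exists A.
apply: smallest_sub; first exact: sigma_algebra_measurable.
case: n => [|n] in f mf *; first by rewrite big_ord0.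
rewrite -bigcup_mkord_ord; apply: bigcup_sub => i Ii.
by move=> A [B mB <-]; exact: mf.
Qed.

Section lebesgue_rV.
Variable R : realType.

(* The library puts Lebesgue measure on the alias [measurableTypeR R], whose
   sigma-algebra is convertible to the one of [R] but has another display. *)
Definition lebesgue1 : set R -> \bar R := @lebesgue_measure R.

HB.instance Definition _ := isMeasure.Build _ R R lebesgue1
  (measure0 (@lebesgue_measure R)) (measure_ge0 (@lebesgue_measure R))
  (@measure_semi_sigma_additive _ _ _ (@lebesgue_measure R)).

Let lebesgue1_sigma_finite : sigma_finite [set: R] lebesgue1.
Proof. exact: (sigma_finiteT (@lebesgue_measure R)). Qed.

HB.instance Definition _ :=
  Measure_isSigmaFinite.Build _ R R lebesgue1 lebesgue1_sigma_finite.

Definition rV_cons n (p : R * 'rV[R]_n) : 'rV[R]_n.+1 :=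
  \row_i if unlift ord0 i is Some j then p.2 ord0 j else p.1.

Definition rV_uncons n (v : 'rV[R]_n.+1) : R * 'rV[R]_n :=
  (v ord0 ord0, \row_j v ord0 (lift ord0 j)).

Lemma rV_consK n : cancel (@rV_cons n) (@rV_uncons n).
Proof.
move=> [a v]; rewrite /rV_uncons /rV_cons mxE unlift_none/=; congr pair.
by apply/rowP => j; rewrite !mxE liftK.
Qed.

Lemma measurable_rV_cons n : measurable_fun [set: R * 'rV[R]_n] (@rV_cons n).
Proof.
apply: measurable_fun_rVP => i; case: (unliftP ord0 i) => [j ->|->].
- rewrite (_ : _ \o _ = @rV_coord _ R n j \o snd).
    by apply: measurableT_comp => //; exact: measurable_rV_coord.
  by apply/funext => p /=; rewrite /rV_coord mxE liftK.
- rewrite (_ : _ \o _ = fst) //.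
  by apply/funext => p /=; rewrite /rV_coord mxE unlift_none.
Qed.

Lemma measurable_rV_uncons n :
  measurable_fun [set: 'rV[R]_n.+1] (@rV_uncons n).
Proof.
apply/measurable_fun_pairP; split => /=; first exact: measurable_rV_coord.
apply: measurable_fun_rVP => i.
rewrite (_ : _ \o _ = @rV_coord _ R n.+1 (lift ord0 i)).
  exact: measurable_rV_coord.
by apply/funext => p /=; rewrite /rV_coord mxE.
Qed.

HB.instance Definition _ n :=
  isMeasurableFun.Build _ _ _ _ (@rV_cons n) (@measurable_rV_cons n).

Section lebesgue_cons.
Variables (n : nat) (m : {sigma_finite_measure set 'rV[R]_n -> \bar R}).

Definition lebesgue_cons : set 'rV[R]_n.+1 -> \bar R :=
  pushforward (lebesgue1 \x m)%E (@rV_cons n).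

Let lebesgue_cons0 : lebesgue_cons set0 = 0%E.
Proof. exact: measure0. Qed.

Let lebesgue_cons_ge0 A : (0 <= lebesgue_cons A)%E.
Proof. exact: measure_ge0. Qed.

Let lebesgue_cons_sigma_additive : semi_sigma_additive lebesgue_cons.
Proof. exact: measure_semi_sigma_additive. Qed.

HB.instance Definition _ := isMeasure.Build _ _ _ lebesgue_cons
  lebesgue_cons0 lebesgue_cons_ge0 lebesgue_cons_sigma_additive.

Let lebesgue_cons_sigma_finite : sigma_finite setT lebesgue_cons.
Proof.
have /sigma_finiteP[F [TF ndF Foo]] := lebesgue1_sigma_finite.
have /sigma_finiteP[G [TG ndG Goo]] := sigma_finiteT m.
exists (fun i => @rV_uncons n @^-1` (F i `*` G i)).
  rewrite -preimage_bigcup (_ : \bigcup_i _ = setT) ?preimage_setT//.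
  apply/seteqP; split => // -[x y] _.
  have [i _ Fx] : (\bigcup_i F i) x by rewrite -TF.
  have [j _ Gy] : (\bigcup_i G i) y by rewrite -TG.
  exists (maxn i j) => //; split => /=.
  - by move: x Fx; exact/subsetPset/ndF/leq_maxl.
  - by move: y Gy; exact/subsetPset/ndG/leq_maxr.
move=> i; have [mF Fi] := Foo i; have [mG Gi] := Goo i; split.
  rewrite -[X in measurable X]setTI; apply: measurable_rV_uncons => //.
  exact: measurableX.
rewrite /lebesgue_cons /pushforward (_ : _ @^-1` _ = F i `*` G i).
  by rewrite product_measure1E// lte_mul_pinfty// ge0_fin_numE.
apply/funext => p.
by rewrite -[LHS]/((F i `*` G i) (rV_uncons (rV_cons p))) rV_consK.
Qed.

HB.instance Definition _ := Measure_isSigmaFinite.Build _ _ _ lebesgue_cons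
  lebesgue_cons_sigma_finite.

End lebesgue_cons.

Fixpoint lebesgue_rV n : {sigma_finite_measure set 'rV[R]_n -> \bar R} :=
  if n is n'.+1 then lebesgue_cons (lebesgue_rV n') else dirac (0 : 'rV[R]_0).

End lebesgue_rV.

Section euclidean.
Variables (R : realType) (n : nat).

Definition dotv (u v : 'rV[R]_n) : R := \sum_i u ord0 i * v ord0 i.

(* The library norm on matrices is the sup norm. *)
Definition enorm (u : 'rV[R]_n) : R := Num.sqrt (dotv u u).

End euclidean.

Section DamekRicci.
Variables (R : realType) (mu nu : nat) (J : {linear 'rV[R]_nu -> 'M[R]_mu}).

Definition heisenberg_type : Prop :=
  (forall z, (J z)^T = - J z) /\
  (forall z, enorm z = 1 -> J z *m (J z)^T = 1%:M).

(* A point (x, z, a) of S is represented in R^mu * R^nu * R, of which [carrier]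
   is the open subset 0 < a; functions on S are total, but only matter there. *)
Local Notation V := ('rV[R]_mu * 'rV[R]_nu * R)%type.
Local Notation ix := 'I_(mu + nu).+1.

Definition carrier : set V := [set p | 0 < p.2].

(* Vectors being rows, J_z x is x *m (J z)^T. *)
Definition bracket (x x' : 'rV[R]_mu) : 'rV[R]_nu :=
  \row_k dotv (x *m (J (delta_mx ord0 k))^T) x'.

Definition mulS (p q : V) : V :=
  (p.1.1 + Num.sqrt p.2 *: q.1.1,
   p.1.2 + p.2 *: q.1.2 + (Num.sqrt p.2 / 2) *: bracket p.1.1 q.1.1,
   p.2 * q.2).

Definition oneS : V := (0, 0, 1).

Definition invS (p : V) : V :=
  (- (Num.sqrt p.2)^-1 *: p.1.1, - p.2^-1 *: p.1.2, p.2^-1).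

Lemma bracketZl c x y : bracket (c *: x) y = c *: bracket x y.
Proof.
apply/rowP => k; rewrite !mxE /dotv big_distrr/=; apply: eq_bigr => i _.
by rewrite -scalemxAl mxE mulrA.
Qed.

Lemma bracketZr c x y : bracket x (c *: y) = c *: bracket x y.
Proof.
apply/rowP => k; rewrite !mxE /dotv big_distrr/=; apply: eq_bigr => i _.
by rewrite [(c *: y) _ _]mxE mulrCA.
Qed.

Lemma bracketxx x : heisenberg_type -> bracket x x = 0.
Proof.
move=> [skew _]; apply/rowP => k; rewrite !mxE.
set A := J _; have dotE (B : 'M[R]_mu) : dotv (x *m B) x = (x *m B *m x^T) 0 0.
  by rewrite mxE; apply: eq_bigr => i _; rewrite [x^T _ _]mxE.
have : dotv (x *m A^T) x = - dotv (x *m A^T) x.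
  rewrite !dotE -[in LHS](trmxK (x *m A^T *m x^T)) mxE !trmx_mul !trmxK mulmxA.
  by rewrite [in RHS]skew mulmxN mulNmx [in RHS]mxE opprK.
by move/eqP; rewrite -addr_eq0 -mulr2n mulrn_eq0/= => /eqP.
Qed.

Lemma mulVS p : heisenberg_type -> carrier p -> mulS (invS p) p = oneS.
Proof.
move=> hJ; case: p => [[x z] a]; rewrite /carrier /= => a0.
rewrite /mulS /invS /oneS /= bracketZl bracketxx// !scaler0 addr0.
by rewrite sqrtrV ?ltW// -!scalerDl !addNr !scale0r mulVf// gt_eqF.
Qed.

Lemma mulSV p : heisenberg_type -> carrier p -> mulS p (invS p) = oneS.
Proof.
move=> hJ; case: p => [[x z] a]; rewrite /carrier /= => a0.
have sa0 : Num.sqrt a != 0 by rewrite gt_eqF// sqrtr_gt0.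
rewrite /mulS /invS /oneS /= bracketZr bracketxx// !scaler0 addr0.
have a_neq0 : a != 0 by rewrite gt_eqF.
by rewrite !scalerA !mulrN !divff// !scaleN1r !subrr.
Qed.

(* [frame p i] is the value at [p] of the i-th left-invariant vector field. *)
Definition frame (p : V) (i : ix) : V :=
  let: (x, _, a) := p in
  match unlift ord0 i with
  | None => (0, 0, a)
  | Some j =>
    match fintype.split j with
    | inl l => let e := delta_mx ord0 l in
        (Num.sqrt a *: e, (Num.sqrt a / 2) *: bracket x e, 0)
    | inr k => (0, a *: delta_mx ord0 k, 0)
    end
  end.

Definition Xder (i : ix) (g : V -> R) : V -> R := fun p => 'D_(frame p i) g p.

Definition XJ (I : seq ix) (g : V -> R) : V -> R := foldr Xder g I.

Definition frame_coord (p v : V) (i : ix) : R :=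
  let: (x, _, a) := p in
  match unlift ord0 i with
  | None => v.2 / a
  | Some j =>
    match fintype.split j with
    | inl l => v.1.1 ord0 l / Num.sqrt a
    | inr k => (v.1.2 ord0 k - 2^-1 * bracket x v.1.1 ord0 k) / a
    end
  end.

Definition metric (p v w : V) : R :=
  \sum_i frame_coord p v i * frame_coord p w i.

Lemma bracket0r x : bracket x 0 = 0.
Proof. by rewrite -(scale0r 0) bracketZr scale0r. Qed.

Lemma frame_coord_frame p i j : carrier p ->
  frame_coord p (frame p i) j = (i == j)%:R.
Proof.
case: p => [[x z] a]; rewrite /carrier/= => a0.
have a_neq0 : a != 0 by rewrite gt_eqF.
have sa0 : Num.sqrt a != 0 by rewrite gt_eqF// sqrtr_gt0.
rewrite /frame /frame_coord.
case: (unliftP ord0 i) => [i' ->|->]; case: (unliftP ord0 j) => [j' ->|->] /=.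
- rewrite (inj_eq lift_inj) -(inj_eq (can_inj splitK)).
  case: (fintype.split i') => [l|l]; case: (fintype.split j') => [l'|l'] /=.
  + rewrite !mxE eqxx /= mulrAC divff// mul1r; congr (nat_of_bool _)%:R.
    by rewrite eq_sym; apply/eqP/eqP => [->//|[]].
  + rewrite bracketZr [X in X - _]mxE [X in _ - _ * X]mxE.
    by rewrite mulrA (mulrC 2^-1) subrr mul0r.
  + by rewrite mxE mul0r.
  + rewrite bracket0r !mxE eqxx /= mulr0 subr0 mulrAC divff// mul1r.
    by congr (nat_of_bool _)%:R; rewrite eq_sym; apply/eqP/eqP => [->//|[]].
- by case: fintype.split => ? /=; rewrite mul0r.
- by case: fintype.split => ? /=; rewrite ?bracket0r !mxE ?mulr0 ?subr0 mul0r.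
- by rewrite divff.
Qed.

Lemma metric_frame p i j : carrier p ->
  metric p (frame p i) (frame p j) = (i == j)%:R.
Proof.
move=> pS; rewrite /metric (bigD1 i)//= !frame_coord_frame// eqxx mul1r.
rewrite big1 ?addr0 1?eq_sym// => k ki.
by rewrite frame_coord_frame// eq_sym (negPf ki) mul0r.
Qed.

Definition C1_path (p q : V) (c : R -> V) : Prop :=
  [/\ c 0 = p, c 1 = q & forall s, s \in `[0, 1] ->
    [/\ carrier (c s), derivable c s 1 & {for s, continuous (derive1 c)}]].

Definition path_length (c : R -> V) : R :=
  \int[lebesgue_measure]_(s in `[0%R, 1%R])
    Num.sqrt (metric (c s) (derive1 c s) (derive1 c s)).

Definition distS (p q : V) : R :=
  inf [set path_length c | c in C1_path p q].

Definition rdist (p : V) : R := distS p oneS.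

(* C^infinity on S: all iterated directional derivatives are differentiable. *)
Definition smoothS (g : V -> R) : Prop :=
  forall (vs : seq V) (p : V), carrier p ->
    differentiable (foldr (fun v f => 'D_v f) g vs) p.

(* The values of the profile [G] on negative reals are irrelevant: its
   derivatives are only used at [rdist p] with [p <> oneS]. *)
Definition radial (g : V -> R) (G : R -> R) : Prop :=
  forall p, carrier p -> g p = G (rdist p).

Definition Qdim : R := (mu + 2 * nu)%:R / 2.

Definition haar_density (p : V) : R :=
  if 0 < p.2 then p.2 `^ (- Qdim - 1) else 0.

Definition haar (A : set V) : \bar R :=
  (\int[(lebesgue_rV R mu \x lebesgue_rV R nu) \x @lebesgue1 R]_(p in A)
     (haar_density p)%:E)%E.

Lemma haar_density_ge0 p : 0 <= haar_density p.
Proof. by rewrite /haar_density; case: ifP => // _; exact: powR_ge0. Qed.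

Lemma measurable_haar_density : measurable_fun setT haar_density.
Proof.
rewrite (_ : haar_density =
  (fun a : R => if 0 < a then a `^ (- Qdim - 1) else 0) \o snd)//.
apply: measurableT_comp => //.
apply: measurable_fun_ifT => //.
exact: measurable_fun_ltr.
Qed.

Let haar0 : haar set0 = 0%E.
Proof. exact: integral_set0. Qed.

Let haar_ge0 A : (0 <= haar A)%E.
Proof.
by apply: integral_ge0 => p _; rewrite lee_fin; exact: haar_density_ge0.
Qed.

Let haar_sigma_additive : semi_sigma_additive haar.
Proof.
apply: semi_sigma_additive_nng_induced.
  by apply/measurable_EFinP; exact: measurable_haar_density.
by move=> p; rewrite lee_fin; exact: haar_density_ge0.
Qed.

HB.instance Definition _ := isMeasure.Build _ _ _ haar
  haar0 haar_ge0 haar_sigma_additive.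

Definition laplacian (f : V -> R) : V -> R := fun p =>
  - (\sum_i Xder i (Xder i f) p) + Qdim * Xder ord0 f p.

Definition convolution (f g : V -> R) : V -> R := fun p =>
  \int[haar]_(q in carrier) (f q * g (mulS (invS q) p)).

Definition test_function (f : V -> R) : Prop :=
  smoothS f /\ exists K : set V,
    [/\ compact K, K `<=` carrier & forall p, ~ K p -> f p = 0].

Definition L2 : set (V -> R) := [set f | f \in Lfun haar 2%:E].

Definition L2norm (f : V -> R) : \bar R := 'N[haar]_2%:E[EFin \o f]%E.

(* The graph of the closure of the Laplacian on test functions, which is
   self-adjoint by essential self-adjointness. *)
Definition laplacian_closure (f g : V -> R) : Prop :=
  exists phi : (V -> R)^nat,
    [/\ forall m, test_function (phi m),
        L2norm (phi m \- f) @[m --> \oo] --> 0%E &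
        L2norm (laplacian (phi m) \- g) @[m --> \oo] --> 0%E].

(* [T t] is the operator [e ^ (- t L)] on L^2: [T] is the strongly continuous
   semigroup of contractions whose infinitesimal generator is the opposite of
   the closure of L. *)
Record heat_semigroup (T : R -> (V -> R) -> V -> R) : Prop := {
  heat_L2 : forall t f, 0 <= t -> L2 f -> L2 (T t f) ;
  heat_linear : forall t c f g, 0 <= t -> L2 f -> L2 g ->
    T t (c \*o f \+ g) = c \*o T t f \+ T t g %[ae haar] ;
  heat_contraction : forall t f, 0 <= t -> L2 f ->
    (L2norm (T t f) <= L2norm f)%E ;
  heat_0 : forall f, L2 f -> T 0 f = f %[ae haar] ;
  heat_D : forall s t f, 0 <= s -> 0 <= t -> L2 f ->
    T (s + t) f = T s (T t f) %[ae haar] ;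
  heat_continuous : forall f, L2 f -> L2norm (T t f \- f) @[t --> 0^'+] --> 0%E ;
  heat_generator : forall f g, L2 f -> L2 g ->
    (L2norm (t^-1 \*o (T t f \- f) \- g) @[t --> 0^'+] --> 0%E) <->
    laplacian_closure f (\- g)
}.

(* [H t] is the radial profile of the heat kernel [h t]. *)
Record heat_kernel (h : R -> V -> R) (H : R -> R -> R) : Prop := {
  heat_kernel_convolution : exists2 T, heat_semigroup T &
    forall t f, 0 < t -> L2 f -> T t f = convolution f (h t) %[ae haar] ;
  heat_kernel_smooth : forall t, 0 < t -> smoothS (h t) ;
  heat_kernel_radial : forall t, 0 < t -> radial (h t) (H t)
}.

(* [sigma j] stands for sigma_(j,I), which only makes sense for 1 <= j <= |I|. *)
Definition radial_coefs (I : seq ix) (sigma : nat -> V -> R) : Prop :=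
  forall g G, smoothS g -> radial g G -> forall p, carrier p -> p <> oneS ->
    XJ I g p = \sum_(1 <= j < (size I).+1) derive1n j G (rdist p) * sigma j p.

(* [Phi G c d] stands for Phi_(c,d) with [c], [d] even, the heat kernel being
   replaced by the profile [G]. *)
Definition Phi (G : R -> R) (c d : nat) (s : R) : R :=
  if c == 0%N then derive1n d.+1 G s
  else \sum_(0 <= l < c) (-1) ^+ l * s ^+ l / l`!%:R * derive1n (d + l).+1 G s.

(* The list of the values given by the recursion for Upsilon_1, Upsilon_3, ...,
   Upsilon_(2 m - 1), where [s] is the value of the distance to [oneS]. *)
Fixpoint upsilon_seq (s : R) (sg : nat -> R) (m : nat) : seq R :=
  if m is j.+1 then
    let us := upsilon_seq s sg j in
    rcons us (sg (2 * j + 1)%N -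
      \sum_(0 <= l < j) s ^+ (2 * j - 2 * l) / (2 * j - 2 * l)`!%:R * us`_l)
  else [::].

(* [Upsilon k sigma j] stands for Upsilon_(2 j + 1,I) with [size I = k] and
   [j <= (k - 1) / 2]. The largest index, equal to k - 1 or k according to the
   parity of k, is not given by the recursion. *)
Definition Upsilon (k : nat) (sigma : nat -> V -> R) (j : nat) (p : V) : R :=
  if j == (k.-1)./2 then sigma (2 * j + 1)%N p
  else (upsilon_seq (rdist p) (fun i => sigma i p) j.+1)`_j.

Lemma size_upsilon_seq s sg m : size (upsilon_seq s sg m) = m.
Proof. by elim: m => //= m IH; rewrite size_rcons IH. Qed.

Lemma upsilon_seqE s sg m l : (l < m)%N ->
  (upsilon_seq s sg m)`_l = (upsilon_seq s sg l.+1)`_l.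
Proof.
elim: m => // m IH; rewrite ltnS leq_eqVlt => /predU1P[->//|lm].
by rewrite [in LHS]/= nth_rcons size_upsilon_seq lm IH.
Qed.

Lemma UpsilonE k sigma j p : (j < (k.-1)./2)%N ->
  Upsilon k sigma j p = sigma (2 * j + 1)%N p -
    \sum_(0 <= l < j) rdist p ^+ (2 * j - 2 * l) / (2 * j - 2 * l)`!%:R *
                      Upsilon k sigma l p.
Proof.
move=> jm; rewrite {1}/Upsilon ltn_eqF// [in LHS]/= nth_rcons.
rewrite size_upsilon_seq ltnn eqxx; congr (_ - _).
apply: eq_big_nat => l /andP[_ lj]; rewrite /Upsilon ltn_eqF ?(ltn_trans lj)//.
by rewrite upsilon_seqE.
Qed.

(* [Xi k sigma j] stands for Xi_(2 j,I), for 1 <= j <= (k - 1) / 2. *)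
Definition Xi (k : nat) (sigma : nat -> V -> R) (j : nat) (p : V) : R :=
  sigma (2 * j)%N p +
  \sum_(0 <= l < j) rdist p ^+ (2 * j - 2 * l - 1) / (2 * j - 2 * l - 1)`!%:R *
                    Upsilon k sigma l p.

End DamekRicci.

(* Main.v *)
Require Import Defs.
From HB Require Import structures.
From mathcomp Require Import all_boot all_order all_algebra.
From mathcomp Require Import all_classical all_reals all_analysis.
From mathcomp Require Import ring lra zify.

Set Implicit Arguments.
Unset Strict Implicit.
Unset Printing Implicit Defensive.

Import Order.TTheory GRing.Theory Num.Theory.
Import numFieldNormedType.Exports.

Local Open Scope classical_set_scope.
Local Open Scope ring_scope.

(** The statement compares a radial function with its derivatives along the
    left-invariant fields.  Everything rests on the closed form of the distance
      cosh (r p) = 2 * rho p - 1,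
      rho (x, z, a) = ((1 + a + |x|^2 / 4)^2 + |z|^2) / (4 a),
    which turns powers of cosh r - c into explicit smooth radial functions.

    Closed form.  The gradient of rho satisfies |grad rho|^2 = rho^2 - rho
    ([sum_rho_grad2]), which expresses that arcosh (2 rho - 1) is 1-Lipschitz;
    integrating along an arbitrary C^1 path bounds its length from below
    ([path_length_ge]).  The bound is attained: in the ball model given by the
    Cayley transform the geodesics through the identity are straight segments,
    and the curves [ray] are their images; they reach every point
    ([ray_surjective]) and their length is computed explicitly
    ([expR_ray_length]).  Hence [expR_rdist].

    Size of sigma.  The coefficients sigma_j at a point p at distance s from
    the identity are found by testing the defining relation on the functions
    (cosh r - cosh s)^m for m = k, k - 1, ..., 1.  The j-th derivative at s of
    the profile of this function vanishes for j < m, equals m! (sinh s)^m for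
    j = m and is O(s^(2m - j)) in general, so the relation is a triangular
    system for the sigma_j.  The left-hand side, X_I of the m-th power at p, is
    O(s^(2m - k)): a function vanishing at p whose first derivatives there are
    O(s) and whose other derivatives are O(1) has order two in s, each field
    lowers the order by one, and orders add up in products ([has_orderX]).
    Solving the system gives sigma_m = O(s^(m - k)) ([sigma_le]), and the
    recursion for Upsilon preserves this estimate ([Upsilon_le]).

    Identities.  Eliminating sigma in favour of Upsilon and Xi in
    X_I h_t = sum_j h_t^(j)(r) sigma_j, the coefficient of each Upsilon is an
    alternating Taylor sum, which is Phi ([odd_even_identity]). *)

(** * Functions polynomial in the coordinates, sqrt a and 1 / sqrt a *)

(** Applied below on the open half-space: outside of it sqrt a is not smooth
    and does not square to a. *)
Lemma near_differentiable (R : numFieldType) (V W : normedModType R)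
    (f g : V -> W) p :
  (\near p, f p = g p) -> differentiable f p -> differentiable g p.
Proof.
move=> fg df; have [cd /eqaddoP E] := (diff_locallyP p f).1 df.
have gp : g p = f p by rewrite (nbhs_singleton fg).
have Eg : g \o shift p = cst (g p) + 'd f p +o_ 0 id.
  apply/eqaddoP => e e0; have := E e e0; rewrite gp.
  have fg0 : \forall h \near (0 : V), f (h + p) = g (h + p).
    move: fg; rewrite (near_shift 0)/=; apply: filterS => h.
    by rewrite /= subr0.
  move: fg0; apply: filterS2 => h fgh.
  by rewrite !fctE /= fgh.
by apply/diff_locallyP; have -> := diff_unique cd Eg; split.
Qed.

Section tame.
Variables (R : realType) (mu nu : nat).
Local Notation V := ('rV[R]_mu * 'rV[R]_nu * R)%type.
Local Notation S := (@carrier R mu nu).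

(** The ring generated by the coordinates and the two powers of sqrt a contains
    rho and the components of the frame, is stable under the left-invariant
    fields, and consists of functions that are bounded wherever the generators
    are.  Closure under equality on the half-space only is what allows to
    express a and 1 / a through their square roots. *)
Inductive tame : (V -> R) -> Prop :=
| tame_cst c : tame (fun _ => c)
| tame_x l : tame (fun p => p.1.1 ord0 l)
| tame_z k : tame (fun p => p.1.2 ord0 k)
| tame_sqrt : tame (fun p => Num.sqrt p.2)
| tame_sqrtV : tame (fun p => (Num.sqrt p.2)^-1)
| tameD f g : tame f -> tame g -> tame (fun p => f p + g p)
| tameM f g : tame f -> tame g -> tame (fun p => f p * g p)
| tame_eq f g : (forall p, S p -> f p = g p) -> tame f -> tame g.

Lemma carrier_nbhs p : S p -> \forall q \near p, S q.
Proof.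
move=> Sp; have : continuous (snd : V -> R) by move=> q; exact: cvg_snd.
move=> /(_ p)/cvgr_gt; exact.
Qed.

Lemma derive_eq_on f g (v p : V) : (forall q, S q -> f q = g q) -> S p ->
  'D_v f p = 'D_v g p :> R.
Proof.
move=> fg Sp; apply: near_eq_derive; near=> q; apply: fg; near: q.
exact: carrier_nbhs.
Unshelve. all: by end_near. Qed.

Lemma tame_sum n (f : 'I_n -> V -> R) : (forall i, tame (f i)) ->
  tame (fun p => \sum_i f i p).
Proof.
elim: n f => [|n IH] f tf.
  apply: (@tame_eq (fun=> 0)); last exact: tame_cst.
  by move=> p _; rewrite big_ord0.
apply: (@tame_eq (fun p =>
    \sum_(i < n) f (widen_ord (leqnSn n) i) p + f ord_max p)).
  by move=> p _; rewrite big_ord_recr.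
by apply: tameD => //; apply: IH.
Qed.

Lemma tameX f n : tame f -> tame (fun p => f p ^+ n).
Proof.
move=> tf; elim: n => [|n IH]; first exact: tame_cst.
apply: (@tame_eq (fun p => f p * f p ^+ n)); first by move=> p _; rewrite exprS.
exact: tameM.
Qed.

Lemma tame_height : tame (fun p => p.2).
Proof.
apply: (@tame_eq (fun p => Num.sqrt p.2 ^+ 2)).
  by move=> p Sp; rewrite sqr_sqrtr// ltW.
by apply: tameX; exact: tame_sqrt.
Qed.

Lemma tame_heightV : tame (fun p => p.2^-1).
Proof.
apply: (@tame_eq (fun p => (Num.sqrt p.2)^-1 ^+ 2)).
  by move=> p Sp; rewrite exprVn sqr_sqrtr// ltW.
by apply: tameX; exact: tame_sqrtV.
Qed.

Lemma linear_is_diff (f : V -> R) p : linear f -> continuous f -> is_diff p f f.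
Proof.
move=> lin cf; pose A := GRing.isLinear.Build _ _ _ _ _ lin.
pose L : {linear V -> R} := HB.pack f A.
apply: DiffDef; first exact: (linear_differentiable (f := L)).
by rewrite (diff_lin _ (cf : continuous L)).
Qed.

Lemma is_diff_x l (p : V) :
  is_diff p (fun q : V => q.1.1 ord0 l) (fun v => v.1.1 ord0 l).
Proof.
apply: linear_is_diff => [c u v|q]; first by rewrite !mxE.
apply: (@continuous_comp _ _ _ (fun v : V => v.1.1) (fun x => x ord0 l)).
  by apply: (@continuous_comp _ _ _ fst fst); exact: cvg_fst.
exact: coord_continuous.
Qed.

Lemma is_diff_z k (p : V) :
  is_diff p (fun q : V => q.1.2 ord0 k) (fun v => v.1.2 ord0 k).
Proof.
apply: linear_is_diff => [c u v|q]; first by rewrite !mxE.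
apply: (@continuous_comp _ _ _ (fun v : V => v.1.2) (fun x => x ord0 k)).
  by apply: (@continuous_comp _ _ _ fst snd); [exact: cvg_fst|exact: cvg_snd].
exact: coord_continuous.
Qed.

Lemma is_diff_height (p : V) : is_diff p (fun q : V => q.2) (fun v => v.2).
Proof. by apply: linear_is_diff => [c u v|q]; [|exact: cvg_snd]. Qed.

Lemma is_diff_sqrt_height (p : V) : S p ->
  is_diff p (fun q : V => Num.sqrt q.2) (fun v => v.2 / (2 * Num.sqrt p.2)).
Proof.
move=> Sp; have [ds ss] := is_diff_height p.
have [d1 d2] : is_derive (p.2 : R) 1 Num.sqrt (2 * Num.sqrt p.2)^-1.
  exact: is_derive1_sqrt.
have dq : differentiable (Num.sqrt : R -> R) p.2 by exact/derivable1_diffP.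
apply: DiffDef; first exact: differentiable_comp.
rewrite (_ : (fun q : V => _) = Num.sqrt \o (fun q : V => q.2))//.
rewrite diff_comp// ss diff1E// derive1E d2.
by apply/funext.
Qed.

Lemma tame_differentiable f p : tame f -> S p -> differentiable f p.
Proof.
move=> tf Sp; elim: tf.
- by move=> c; exact: differentiable_cst.
- by move=> l; have [] := is_diff_x l p.
- by move=> k; have [] := is_diff_z k p.
- by have [] := is_diff_sqrt_height Sp.
- apply: differentiableV; first by have [] := is_diff_sqrt_height Sp.
  by rewrite gt_eqF// sqrtr_gt0.
- by move=> ? ? _ df _ dg; exact: differentiableD.
- by move=> ? ? _ df _ dg; exact: differentiableM.
- move=> f' g fg _; apply: near_differentiable; near=> q; apply: fg; near: q.
  exact: carrier_nbhs.
Unshelve. all: by end_near. Qed.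

Lemma tame_derivable f p v : tame f -> S p -> derivable f p v.
Proof. by move=> tf Sp; apply/diff_derivable/tame_differentiable. Qed.

Lemma derive_tameM f g p v : tame f -> tame g -> S p ->
  'D_v (fun p => f p * g p) p = 'D_v f p * g p + f p * 'D_v g p.
Proof.
move=> tf tg Sp.
rewrite (_ : (fun p => _) = f * g)//.
rewrite deriveM; [|exact: tame_derivable..].
by rewrite addrC [g p *: _]mulrC.
Qed.

Lemma derive_tameD f g p v : tame f -> tame g -> S p ->
  'D_v (fun p => f p + g p) p = 'D_v f p + 'D_v g p.
Proof.
move=> tf tg Sp.
rewrite (_ : (fun p => _) = f + g)//.
by rewrite deriveD; [|exact: tame_derivable..].
Qed.

Record tame_field (v : V -> V) : Prop := {
  tame_field_x : forall l, tame (fun p => (v p).1.1 ord0 l);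
  tame_field_z : forall k, tame (fun p => (v p).1.2 ord0 k);
  tame_field_height : tame (fun p => (v p).2) }.

(** Constant fields give partial derivatives, hence smoothness; the frame gives
    stability under the left-invariant fields. *)
Lemma tame_derive v f : tame_field v -> tame f -> tame (fun p => 'D_(v p) f p).
Proof.
move=> tv tf; elim: tf.
- move=> c; apply: (tame_eq _ (tame_cst 0)) => p _.
  by rewrite (_ : (fun=> c) = cst c)// derive_cst.
- move=> l; apply: (tame_eq _ (tame_field_x tv l)) => p _.
  by have [df E] := is_diff_x l p; rewrite deriveE// E.
- move=> k; apply: (tame_eq _ (tame_field_z tv k)) => p _.
  by have [df E] := is_diff_z k p; rewrite deriveE// E.
- have := tameM (tameM (tame_field_height tv) tame_sqrtV) (tame_cst 2^-1).
  apply: tame_eq => p Sp.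
  by have [df E] := is_diff_sqrt_height Sp; rewrite deriveE// E invfM; lra.
- have := tameM (tameM (tame_field_height tv) (tameX 3 tame_sqrtV))
    (tame_cst (- 2^-1)).
  apply: tame_eq => p Sp; have [df E] := is_diff_sqrt_height Sp.
  have s0 : Num.sqrt p.2 != 0 by rewrite gt_eqF// sqrtr_gt0.
  rewrite deriveV//; last exact: diff_derivable.
  rewrite deriveE// E [RHS]/(_ *: _)/=; field.
  exact: s0.
- move=> f' g tf tdf tg tdg; apply: (tame_eq _ (tameD tdf tdg)) => p Sp.
  by rewrite derive_tameD.
- move=> f' g tf tdf tg tdg.
  apply: (tame_eq _ (tameD (tameM tdf tg) (tameM tf tdg))) => p Sp.
  by rewrite derive_tameM.
- move=> f' g fg _ tdf; apply: (tame_eq _ tdf) => p Sp.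
  exact: derive_eq_on.
Qed.

Lemma tame_smooth f : tame f -> smoothS f.
Proof.
move=> tf vs p; apply: tame_differentiable.
elim: vs => //= v vs; apply: tame_derive.
by split => *; exact: tame_cst.
Qed.

Section fields.
Variable J : {linear 'rV[R]_nu -> 'M[R]_mu}.

Lemma tame_frame i : tame_field (fun p => frame J p i).
Proof.
rewrite /frame; case: (unliftP ord0 i) => [j _|_]; last first.
  split=> [l|k|].
  - by apply: (tame_eq _ (tame_cst 0)) => -[[x z] a] _; rewrite mxE.
  - by apply: (tame_eq _ (tame_cst 0)) => -[[x z] a] _; rewrite mxE.
  - by apply: (tame_eq _ tame_height) => -[[x z] a] _.
case: (fintype.split j) => [l0|k0]; split=> [l|k|].
- apply: (tame_eq _ (tameM tame_sqrt (tame_cst ((l == l0)%:R)))).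
  by move=> -[[x z] a] _ /=; rewrite !mxE.
- pose h i (p : V) := (\sum_l p.1.1 ord0 l * (J (delta_mx ord0 k))^T l i) *
    (delta_mx ord0 l0 : 'rV[R]_mu) ord0 i.
  have th : tame (fun p => Num.sqrt p.2 * 2^-1 * \sum_i h i p).
    apply: tameM; first exact: (tameM tame_sqrt (tame_cst _)).
    apply: tame_sum => m; apply: tameM; last exact: tame_cst.
    apply: tame_sum => m'; apply: tameM; [exact: tame_x|exact: tame_cst].
  apply: (tame_eq _ th) => -[[x z] a] _ /=.
  rewrite [RHS]mxE [bracket _ _ _ _ _]mxE /dotv; congr (_ * _).
  by apply: eq_bigr => m _; rewrite /h [in RHS]mxE.
- by apply: (tame_eq _ (tame_cst 0)) => -[[x z] a] _.
- by apply: (tame_eq _ (tame_cst 0)) => -[[x z] a] _; rewrite mxE.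
- apply: (tame_eq _ (tameM tame_height (tame_cst ((k == k0)%:R)))).
  by move=> -[[x z] a] _ /=; rewrite !mxE.
- by apply: (tame_eq _ (tame_cst 0)) => -[[x z] a] _.
Qed.

Lemma tame_Xder i f : tame f -> tame (Xder J i f).
Proof. by apply: tame_derive; exact: tame_frame. Qed.

Lemma tame_XJ I f : tame f -> tame (XJ J I f).
Proof. by move=> tf; elim: I => //= i I; exact: tame_Xder. Qed.

Lemma XJ_eq_on I f g p : (forall q, S q -> f q = g q) -> S p ->
  XJ J I f p = XJ J I g p.
Proof.
move=> fg; elim: I p => [|i I IH] p Sp /=; first exact: fg.
by apply: derive_eq_on => // q Sq; exact: IH.
Qed.

Lemma XJ_rcons I i f : XJ J (rcons I i) f = XJ J I (Xder J i f).
Proof. by rewrite /XJ -cats1 foldr_cat. Qed.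

Lemma XJD I f g p : tame f -> tame g -> S p ->
  XJ J I (fun q => f q + g q) p = XJ J I f p + XJ J I g p.
Proof.
move=> tf tg; elim: I p => [//|i I IH] p Sp /=.
by rewrite /Xder (derive_eq_on _ IH)// derive_tameD//; exact: tame_XJ.
Qed.

Lemma XJ_cst I c p : S p -> XJ J I (fun=> c) p = if I is [::] then c else 0.
Proof.
elim: I p => [//|i I IH] p Sp /=.
have [c' Ec] : exists c', forall q, S q -> XJ J I (fun=> c) q = cst c' q.
  by exists (if I is [::] then c else 0) => q /IH ->.
by rewrite /Xder (derive_eq_on _ Ec)// derive_cst.
Qed.

End fields.
End tame.

Arguments tame_cst {R mu nu} c.
Arguments tame_x {R mu nu} l.
Arguments tame_z {R mu nu} k.
Arguments tame_height {R mu nu}.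
Arguments tame_heightV {R mu nu}.

(** * Orders of vanishing add up in products *)

Section order.
Variables (R : realType) (mu nu : nat) (J : {linear 'rV[R]_nu -> 'M[R]_mu}).
Local Notation V := ('rV[R]_mu * 'rV[R]_nu * R)%type.
Local Notation S := (@carrier R mu nu).
Local Notation ix := 'I_(mu + nu).+1.

(** Heuristically, f behaves near p like a function that is homogeneous of
    degree w in the scale s.  Negative w is allowed: repeated differentiation of
    a bounded function is compared with negative powers of s. *)
Definition has_order (s : R) (K : nat) (w : int) (c : R) (f : V -> R) (p : V) :=
  forall I : seq ix, (size I <= K)%N ->
    `|XJ J I f p| <= c * s ^ (w - (size I)%:Z).

Lemma has_orderW s K w c f p : has_order s K w c f p -> has_order s 0 w c f p.
Proof. by move=> o I; rewrite leqn0 => /nilP ->; exact: o. Qed.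

Lemma has_order_value s w c f p : has_order s 0 w c f p ->
  `|f p| <= c * s ^ w.
Proof. by move=> /(_ [::] isT) /=; rewrite subr0. Qed.

Lemma has_order_ge0 s w c f p : 0 < s -> has_order s 0 w c f p -> 0 <= c.
Proof.
move=> s0 /has_order_value fp; rewrite -(pmulr_lge0 _ (exprz_gt0 w s0)).
exact: le_trans fp.
Qed.

(** The Leibniz rule for the innermost field replaces one of the two factors by
    its derivative, whose order is smaller by one; the number of resulting terms
    at most doubles with each field. *)
Lemma has_orderM s K w1 w2 c1 c2 f g p : 0 < s -> tame f -> tame g -> S p ->
  has_order s K w1 c1 f p -> has_order s K w2 c2 g p ->
  has_order s K (w1 + w2) (2 ^+ K * (c1 * c2)) (fun q => f q * g q) p.
Proof.
move=> s0 tf tg Sp.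
elim: K f g w1 w2 tf tg => [|K IH] f g w1 w2 tf tg of_ og.
  move=> I; rewrite leqn0 => /nilP -> /=; rewrite expr0 mul1r subr0.
  rewrite normrM expfzDr ?gt_eqF// mulrACA.
  by rewrite ler_pM//; exact: has_order_value.
have [of0 og0] := (has_orderW of_, has_orderW og).
move=> I; case/lastP: I => [_|I i] /=.
  rewrite subr0 normrM; apply: (@le_trans _ _ (c1 * c2 * s ^ (w1 + w2))).
    by rewrite expfzDr ?gt_eqF// mulrACA ler_pM//; exact: has_order_value.
  rewrite ler_pM2r ?exprz_gt0// ler_peMl ?exprn_ege1 ?ler1n//.
  by rewrite mulr_ge0//; [exact: has_order_ge0 of0|exact: has_order_ge0 og0].
rewrite size_rcons ltnS => sI.
have shift h w c : has_order s K.+1 w c h p ->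
    has_order s K w c h p /\ has_order s K (w - 1) c (Xder J i h) p.
  move=> o; split=> I' sI'; first by apply: o; exact: leqW.
  rewrite -XJ_rcons; apply: (le_trans (o _ _)); first by rewrite size_rcons.
  have <- : w - (size I').+1%:Z = w - 1 - (size I')%:Z by lia.
  by rewrite size_rcons.
have [of1 of2] := shift _ _ _ of_; have [og1 og2] := shift _ _ _ og.
have tXf := tame_Xder J i tf; have tXg := tame_Xder J i tg.
have b1 := IH _ _ _ _ tXf tg of2 og1 I sI.
have b2 := IH _ _ _ _ tf tXg of1 og2 I sI.
rewrite XJ_rcons (@XJ_eq_on _ _ _ J _ _
  (fun q => Xder J i f q * g q + f q * Xder J i g q))//; last first.
  by move=> q Sq; rewrite /Xder derive_tameM.
rewrite XJD//; [|exact: tameM..].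
apply: (le_trans (ler_normD _ _)); apply: (le_trans (lerD b1 b2)).
have -> : w1 - 1 + w2 - (size I)%:Z = w1 + w2 - (size I).+1%:Z by lia.
have -> : w1 + (w2 - 1) - (size I)%:Z = w1 + w2 - (size I).+1%:Z by lia.
by rewrite -mulrDl ler_pM2r ?exprz_gt0// exprS -mulrA mulr_natl mulr2n.
Qed.

Lemma has_orderX s K c f p m : 0 < s -> tame f -> S p ->
  has_order s K 2 c f p ->
  has_order s K (2 * m)%:Z ((2 ^+ K * c) ^+ m) (fun q => f q ^+ m) p.
Proof.
move=> s0 tf Sp of_; elim: m => [|m IH].
  move=> I _; rewrite (XJ_eq_on J I (g := fun=> 1))//.
  rewrite XJ_cst// muln0 expr0 mul1r; case: I => [|i I] /=.
    by rewrite subr0 expr0z normr1.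
  by rewrite normr0 exprz_ge0// ltW.
move=> I sI; rewrite (XJ_eq_on J I (g := fun q => f q * f q ^+ m))//.
have := has_orderM s0 tf (tameX m tf) Sp of_ IH sI.
  by rewrite mulnS PoszD exprS -[2 ^+ K * c * _]mulrA.
by move=> q _; rewrite exprS.
Qed.

Definition generators_le (M : R) (p : V) :=
  [/\ forall l, `|p.1.1 ord0 l| <= M, forall k, `|p.1.2 ord0 k| <= M,
      Num.sqrt p.2 <= M & (Num.sqrt p.2)^-1 <= M].

Lemma tame_bounded (B : set V) M f : B `<=` S ->
  (forall p, B p -> generators_le M p) ->
  tame f -> exists C, forall p, B p -> `|f p| <= C.
Proof.
move=> BS bM; elim.
- by move=> c; exists `|c|.
- by move=> l; exists M => p /bM[].
- by move=> k; exists M => p /bM[].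
- by exists M => p /bM[_ _ ? _]; rewrite ger0_norm// sqrtr_ge0.
- by exists M => p /bM[_ _ _ ?]; rewrite ger0_norm// invr_ge0 sqrtr_ge0.
- move=> g h _ [C1 H1] _ [C2 H2]; exists (C1 + C2) => p Bp.
  by apply: (le_trans (ler_normD _ _)); rewrite lerD ?H1 ?H2.
- move=> g h _ [C1 H1] _ [C2 H2]; exists (C1 * C2) => p Bp.
  by rewrite normrM ler_pM ?H1 ?H2.
- move=> g h gh _ [C H]; exists C => p Bp; rewrite -gh ?H//; exact: BS.
Qed.

Lemma XJ_bounded (B : set V) M K f : B `<=` S ->
  (forall p, B p -> generators_le M p) ->
  tame f ->
  exists C, forall I p, (size I <= K)%N -> B p -> `|XJ J I f p| <= C.
Proof.
move=> BS bM; elim: K f => [|K IH] f tf.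
  have [C H] := tame_bounded BS bM tf.
  by exists C => I p; rewrite leqn0 => /nilP -> /H.
have [C H] := tame_bounded BS bM tf.
have H' i : exists C', forall I p, (size I <= K)%N -> B p ->
    `|XJ J I (Xder J i f) p| <= C'.
  by apply: IH; exact: tame_Xder.
pose C' i := projT1 (cid (H' i)).
have PC' i I p : (size I <= K)%N -> B p -> `|XJ J I (Xder J i f) p| <= C' i.
  by rewrite /C'; case: cid => /= c; exact.
exists (`|C| + \sum_i `|C' i|) => I p.
have sum0 (P : pred ix) : 0 <= \sum_(i | P i) `|C' i| by exact: sumr_ge0.
case/lastP: I => [_ Bp|I i].
  rewrite (le_trans (H p Bp))// (le_trans (ler_norm _))// lerDl; exact: sum0.
rewrite size_rcons ltnS XJ_rcons => sI Bp.
rewrite (le_trans (PC' i I p sI Bp))// (le_trans (ler_norm _))//.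
by rewrite (bigD1 i)//= addrCA lerDl addr_ge0.
Qed.

End order.

(** * The algebra of Heisenberg-type structures *)

Section dotv.
Variable R : realType.

Lemma dotvE n (u v : 'rV[R]_n) : dotv u v = (u *m v^T) ord0 ord0.
Proof. by rewrite mxE; apply: eq_bigr => i _; rewrite [v^T _ _]mxE. Qed.

Lemma dotvC n (u v : 'rV[R]_n) : dotv u v = dotv v u.
Proof. by apply: eq_bigr => i _; rewrite mulrC. Qed.

Lemma dotvDl n (u v w : 'rV[R]_n) : dotv (u + v) w = dotv u w + dotv v w.
Proof. by rewrite !dotvE mulmxDl mxE. Qed.

Lemma dotvZl n c (u w : 'rV[R]_n) : dotv (c *: u) w = c * dotv u w.
Proof. by rewrite !dotvE -scalemxAl mxE. Qed.

Lemma dotvDr n (u v w : 'rV[R]_n) : dotv w (u + v) = dotv w u + dotv w v.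
Proof. by rewrite dotvC dotvDl !(dotvC w). Qed.

Lemma dotvZr n c (u w : 'rV[R]_n) : dotv w (c *: u) = c * dotv w u.
Proof. by rewrite dotvC dotvZl !(dotvC w). Qed.

Lemma dotvNl n (u w : 'rV[R]_n) : dotv (- u) w = - dotv u w.
Proof. by rewrite -scaleN1r dotvZl mulN1r. Qed.

Lemma dotvNr n (u w : 'rV[R]_n) : dotv w (- u) = - dotv w u.
Proof. by rewrite dotvC dotvNl dotvC. Qed.

Lemma dotv_ge0 n (u : 'rV[R]_n) : 0 <= dotv u u.
Proof. by apply: sumr_ge0 => i _; rewrite -expr2 sqr_ge0. Qed.

Lemma sqr_coord_le_dotv n (u : 'rV[R]_n) i : u ord0 i ^+ 2 <= dotv u u.
Proof.
rewrite /dotv (bigD1 i)//= -expr2 lerDl.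
by apply: sumr_ge0 => j _; rewrite -expr2 sqr_ge0.
Qed.

Lemma dotv_eq0 n (u : 'rV[R]_n) : dotv u u = 0 -> u = 0.
Proof.
move=> u0; apply/rowP => i; rewrite mxE; apply/eqP; rewrite -sqrf_eq0.
by rewrite eq_le sqr_ge0 -u0 sqr_coord_le_dotv.
Qed.

Lemma sum_cauchy_schwarz n (f g : 'I_n -> R) :
  (\sum_i f i * g i) ^+ 2 <= (\sum_i f i ^+ 2) * (\sum_i g i ^+ 2).
Proof.
have Dg (h k : 'I_n -> R) :
    (\sum_i h i) * (\sum_i k i) = \sum_i \sum_j h i * k j.
  by rewrite big_distrl; apply: eq_bigr => i _; rewrite big_distrr.
have : 0 <= \sum_i \sum_j (f i * g j - f j * g i) ^+ 2.
  by apply: sumr_ge0 => i _; apply: sumr_ge0 => j _; exact: sqr_ge0.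
have -> : \sum_i \sum_j (f i * g j - f j * g i) ^+ 2 =
    \sum_i \sum_j f i ^+ 2 * g j ^+ 2 + \sum_i \sum_j g i ^+ 2 * f j ^+ 2
    - 2 * \sum_i \sum_j (f i * g i) * (f j * g j).
  rewrite mulr_sumr -big_split -sumrB; apply: eq_bigr => i _.
  rewrite mulr_sumr -big_split -sumrB; apply: eq_bigr => j _ /=; ring.
rewrite -!Dg expr2; lra.
Qed.

End dotv.

Section heisenberg.
Variables (R : realType) (mu nu : nat) (J : {linear 'rV[R]_nu -> 'M[R]_mu}).
Hypothesis hJ : heisenberg_type J.

(** This is J_z x, vectors being rows. *)
Definition Jmap (z : 'rV[R]_nu) (x : 'rV[R]_mu) : 'rV[R]_mu := x *m (J z)^T.

Lemma dotv_Jmap z x y : dotv (Jmap z x) y = dotv z (bracket J x y).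
Proof.
rewrite /Jmap [in LHS](row_sum_delta z) linear_sum linear_sum mulmx_sumr.
rewrite dotvE mulmx_suml summxE; apply: eq_bigr => k _.
rewrite linearZ/= linearZ/= -scalemxAr -scalemxAl.
by rewrite [LHS]mxE [bracket _ _ _ _ _]mxE dotvE.
Qed.

Lemma dotv_Jmap_skew z x y : dotv (Jmap z x) y = - dotv x (Jmap z y).
Proof.
have [skew _] := hJ.
by rewrite !dotvE /Jmap trmx_mul trmxK mulmxA skew mulmxN mulNmx mxE.
Qed.

Lemma dotv_Jmapxx z x : dotv (Jmap z x) x = 0.
Proof. by have := dotv_Jmap_skew z x x; rewrite [dotv x _]dotvC; lra. Qed.

(** Homogeneity extends the orthogonality of J_z from unit vectors z. *)
Lemma mulJT z : J z *m (J z)^T = (dotv z z)%:M.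
Proof.
have [z0|z0] := eqVneq (dotv z z) 0.
  by rewrite z0 (dotv_eq0 z0) linear0 mul0mx raddf0.
have [_ iso] := hJ.
have n0 : enorm z != 0.
  by rewrite gt_eqF// sqrtr_gt0 lt_def z0 dotv_ge0.
have nz : enorm z ^+ 2 = dotv z z by rewrite sqr_sqrtr// dotv_ge0.
have := iso ((enorm z)^-1 *: z).
rewrite {1}/enorm dotvZl dotvZr mulrA -expr2 -nz -exprMn mulVf// expr1n sqrtr1.
move=> /(_ erefl); rewrite linearZ/= linearZ/= -scalemxAr -scalemxAl scalerA.
move=> /(congr1 ( *:%R (enorm z ^+ 2))); rewrite scalerA scalemx1 => <-.
by rewrite -expr2 -exprMn mulfV// expr1n scale1r.
Qed.

Lemma JmapK z x : Jmap z (Jmap z x) = - dotv z z *: x.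
Proof.
have [skew _] := hJ; rewrite /Jmap -mulmxA [X in _ *m (X *m _)]skew.
by rewrite mulNmx mulmxN mulJT mul_mx_scalar scaleNr.
Qed.

Lemma dotv_JmapJmap z x : dotv (Jmap z x) (Jmap z x) = dotv z z * dotv x x.
Proof. by rewrite dotv_Jmap_skew JmapK dotvZr mulNr opprK. Qed.

Lemma JmapDl z w x : Jmap (z + w) x = Jmap z x + Jmap w x.
Proof. by rewrite /Jmap linearD linearD mulmxDr. Qed.

Lemma JmapZl c z x : Jmap (c *: z) x = c *: Jmap z x.
Proof. by rewrite /Jmap linearZ/= linearZ/= -scalemxAr. Qed.

Lemma JmapDr z x y : Jmap z (x + y) = Jmap z x + Jmap z y.
Proof. by rewrite /Jmap mulmxDl. Qed.

Lemma JmapZr c z x : Jmap z (c *: x) = c *: Jmap z x.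
Proof. by rewrite /Jmap -scalemxAl. Qed.

(** Polarization of [dotv_JmapJmap] in z. *)
Lemma dotv_Jmap2 z w x : dotv (Jmap z x) (Jmap w x) = dotv z w * dotv x x.
Proof.
have := dotv_JmapJmap (z + w) x.
rewrite JmapDl !(dotvDl, dotvDr) !dotv_JmapJmap [dotv (Jmap w x) _]dotvC.
by rewrite [dotv w z]dotvC; lra.
Qed.

(** The plane spanned by x and J_z x brackets into the line of z; this is why
    the curves [ray] below only involve four scalar functions. *)
Lemma bracket_Jmap z x : bracket J x (Jmap z x) = dotv x x *: z.
Proof.
apply/rowP => k; rewrite mxE -/(Jmap _ _) dotv_Jmap2 mulrC mxE; congr (_ * _).
rewrite /dotv (bigD1 k)//= mxE !eqxx mul1r big1 ?addr0// => i /negPf ik.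
by rewrite mxE ik mul0r.
Qed.

Lemma bracketC x y : bracket J y x = - bracket J x y.
Proof.
by apply/rowP => k; rewrite !mxE -!/(Jmap _ _) dotv_Jmap_skew dotvC.
Qed.

Lemma bracketDl x x' y : bracket J (x + x') y = bracket J x y + bracket J x' y.
Proof. by apply/rowP => k; rewrite !mxE -!/(Jmap _ _) JmapDr dotvDl. Qed.

Lemma bracketDr x y y' : bracket J x (y + y') = bracket J x y + bracket J x y'.
Proof. by apply/rowP => k; rewrite !mxE -!/(Jmap _ _) dotvDr. Qed.

End heisenberg.

(** * The function rho = cosh(r/2)^2 and its gradient *)

Section rho.
Variables (R : realType) (mu nu : nat) (J : {linear 'rV[R]_nu -> 'M[R]_mu}).
Hypothesis hJ : heisenberg_type J.
Local Notation V := ('rV[R]_mu * 'rV[R]_nu * R)%type.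
Local Notation S := (@carrier R mu nu).

(** The real part of the denominator of the Cayley transform, of which
    |z| is the imaginary part. *)
Definition cayley_height (p : V) : R := 1 + p.2 + dotv p.1.1 p.1.1 / 4.
Definition rho (p : V) : R :=
  (cayley_height p ^+ 2 + dotv p.1.2 p.1.2) / (4 * p.2).

Lemma rhoE p : S p -> 4 * p.2 * rho p = cayley_height p ^+ 2 + dotv p.1.2 p.1.2.
Proof. by move=> Sp; rewrite /rho mulrC divfK// mulf_neq0// gt_eqF. Qed.

Lemma cayley_height_ge p : S p -> 1 + p.2 <= cayley_height p.
Proof. by move=> Sp; rewrite lerDl divr_ge0// dotv_ge0. Qed.

Lemma tame_dotv n (f : V -> 'rV[R]_n) :
  (forall i, tame (fun p => f p ord0 i)) ->
  tame (fun p => dotv (f p) (f p)).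
Proof. by move=> tf; apply: tame_sum => i; apply: tameM. Qed.

Lemma tame_rho : tame rho.
Proof.
have tB : tame cayley_height.
  have tx : tame (fun p : V => dotv p.1.1 p.1.1).
    by apply: tame_dotv => i; exact: tame_x.
  exact: (tameD (tameD (tame_cst 1) tame_height) (tameM tx (tame_cst 4^-1))).
have tz : tame (fun p : V => dotv p.1.2 p.1.2).
  by apply: tame_dotv => i; exact: tame_z.
have := tameM (tameM (tameD (tameX 2 tB) tz) tame_heightV) (tame_cst 4^-1).
by apply: tame_eq => p _; rewrite /rho invfM mulrA [_ / 4]mulrC mulrA; lra.
Qed.

Lemma is_derive_dotv n (f : V -> 'rV[R]_n) (p v : V) (df : 'rV[R]_n) :
  (forall i, is_derive p v (fun q => f q ord0 i) (df ord0 i)) ->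
  is_derive p v (fun q => dotv (f q) (f q)) (2 * dotv (f p) df).
Proof.
move=> Hf.
rewrite (_ : (fun q => _) =
    \sum_i (fun q => f q ord0 i) * (fun q => f q ord0 i)); last first.
  by apply/funext => q; rewrite fct_sumE.
apply: is_derive_eq.
rewrite mulr_sumr; apply: eq_bigr => i _; rewrite /GRing.scale/=; ring.
Qed.

Lemma derive_rho p v : S p ->
  'D_v rho p =
    (cayley_height p * (v.2 + dotv p.1.1 v.1.1 / 2) + dotv p.1.2 v.1.2)
      / (2 * p.2) - rho p * v.2 / p.2.
Proof.
move=> Sp; have a0 : p.2 != 0 by rewrite gt_eqF.
have dx : is_derive p v (fun q : V => dotv q.1.1 q.1.1) (2 * dotv p.1.1 v.1.1).
  apply: is_derive_dotv => i; have [df E] := is_diff_x i p.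
  by apply: DeriveDef; [exact: diff_derivable|rewrite deriveE// E].
have dz : is_derive p v (fun q : V => dotv q.1.2 q.1.2) (2 * dotv p.1.2 v.1.2).
  apply: is_derive_dotv => i; have [df E] := is_diff_z i p.
  by apply: DeriveDef; [exact: diff_derivable|rewrite deriveE// E].
have da : is_derive p v (fun q : V => q.2) v.2.
  have [df E] := is_diff_height p.
  by apply: DeriveDef; [exact: diff_derivable|rewrite deriveE// E].
have dV : is_derive p v (fun q : V => (q.2)^-1) (- p.2 ^- 2 * v.2).
  by apply: DeriveDef; [exact: derivableV|rewrite deriveV// derive_val].
pose B := (cst 1 + (fun q : V => q.2)) + 4^-1 \*: (fun q => dotv q.1.1 q.1.1).
rewrite (_ : rho = 4^-1 \*: ((B ^+ 2 + (fun q => dotv q.1.2 q.1.2)) *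
    (fun q : V => (q.2)^-1))); last first.
  apply/funext => q.
  rewrite /rho /cayley_height /B !fctE/= /GRing.scale/= invfM mulrCA.
  congr (_ * (_ * _)).
  by rewrite [4^-1 * _]mulrC.
rewrite derive_val /B !fctE /= /GRing.scale/= /cayley_height.
by field.
Qed.

Lemma sum_frame (F : 'I_(mu + nu).+1 -> R) :
  \sum_i F i = F ord0 + \sum_l F (lift ord0 (lshift nu l))
                      + \sum_k F (lift ord0 (rshift mu k)).
Proof. by rewrite big_ord_recl big_split_ord /= addrA. Qed.

(** The components of the gradient of rho in the left-invariant frame. *)
Definition rho_grad (p : V) (i : 'I_(mu + nu).+1) : R :=
  match unlift ord0 i with
  | None => cayley_height p / 2 - rho p
  | Some j =>
    match fintype.split j with
    | inl l => (cayley_height p *: p.1.1 + Jmap J p.1.2 p.1.1) ord0 l /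
                 (4 * Num.sqrt p.2)
    | inr k => p.1.2 ord0 k / 2
    end
  end.

Lemma split_lshift n m (l : 'I_n) : fintype.split (lshift m l) = inl l.
Proof. exact: (unsplitK (inl l)). Qed.

Lemma split_rshift n m (l : 'I_m) : fintype.split (rshift n l) = inr l.
Proof. exact: (unsplitK (inr l)). Qed.

Lemma derive_rho_grad p v : S p ->
  'D_v rho p = \sum_i frame_coord J p v i * rho_grad p i.
Proof.
move=> Sp; rewrite derive_rho// sum_frame /frame_coord /rho_grad.
case: p Sp => [[x z] a]/= a0; rewrite /carrier/= in a0.
have an0 : a != 0 by rewrite gt_eqF.
have sn0 : Num.sqrt a != 0 by rewrite gt_eqF// sqrtr_gt0.
rewrite unlift_none.
under [X in _ + X + _]eq_bigr => l _.
  rewrite liftK split_lshift.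
  rewrite mulf_div [_ * (4 * _)]mulrCA -expr2 sqr_sqrtr ?ltW//.
  rewrite mulrC.
  over.
under [X in _ + _ + X]eq_bigr => k _.
  rewrite liftK split_rshift.
  rewrite mulf_div mulrC mulrBl mulrBr.
  over.
rewrite -mulr_sumr; set s1 := \sum_i _.
have -> : s1 =
    cayley_height (x, z, a) * dotv x v.1.1 + dotv z (bracket J x v.1.1).
  rewrite -dotv_Jmap -dotvZl -dotvDl dotvC; apply: eq_bigr => l _.
  by rewrite ![in RHS]mxE !mxE.
rewrite sumrB -!mulr_sumr.
have -> : \sum_i v.1.2 ord0 i * z ord0 i = dotv z v.1.2 by rewrite dotvC.
have -> : \sum_i 2^-1 * bracket J x v.1.1 ord0 i * z ord0 i =
    2^-1 * dotv z (bracket J x v.1.1).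
  by rewrite dotvC mulr_sumr; apply: eq_bigr => i _; rewrite mulrA.
by field.
Qed.

(** The eikonal equation.  The x-part of the gradient is computed from
    |B x + J_z x|^2 = (B^2 + |z|^2) |x|^2 = 4 a rho |x|^2, and the rest cancels
    because B = 1 + a + |x|^2 / 4. *)
Lemma sum_rho_grad2 p : S p -> \sum_i rho_grad p i ^+ 2 = rho p ^+ 2 - rho p.
Proof.
move=> Sp; rewrite sum_frame /rho_grad unlift_none.
case: p Sp => [[x z] a]/= a0; rewrite /carrier/= in a0.
have an0 : a != 0 by rewrite gt_eqF.
under [X in _ + X + _]eq_bigr => l _.
  rewrite liftK split_lshift expr_div_n exprMn sqr_sqrtr ?ltW// mulrC expr2.
  over.
under [X in _ + _ + X]eq_bigr => k _.
  rewrite liftK split_rshift expr_div_n mulrC expr2.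
  over.
rewrite -!mulr_sumr -!/(dotv _ _).
rewrite !(dotvDl, dotvDr, dotvZl, dotvZr) dotv_JmapJmap// dotv_Jmapxx//.
rewrite [dotv x (Jmap _ _ _)]dotvC dotv_Jmapxx//.
rewrite /rho /cayley_height /=; field.
by rewrite an0.
Qed.

Lemma derive_rho_le p v : S p ->
  ('D_v rho p) ^+ 2 <= (rho p ^+ 2 - rho p) * metric J p v v.
Proof.
move=> Sp; rewrite derive_rho_grad// -sum_rho_grad2// mulrC /metric.
under [X in _ <= X * _]eq_bigr do rewrite -expr2.
exact: sum_cauchy_schwarz.
Qed.

Lemma rho_ge1 p : S p -> 1 <= rho p.
Proof.
move=> Sp; have B1 := cayley_height_ge Sp; have E := rhoE Sp.
have z0 := dotv_ge0 p.1.2; rewrite /carrier/= in Sp.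
rewrite -(ler_pM2l (_ : 0 < 4 * p.2)) ?mulr_gt0// E mulr1.
have : 0 <= (1 - p.2) ^+ 2 by exact: sqr_ge0.
nra.
Qed.

Lemma rho_oneS : rho (oneS R mu nu) = 1.
Proof.
rewrite /rho /cayley_height /oneS /= !dotvE !mul0mx !mxE.
by field.
Qed.

Lemma rho_eq1 p : S p -> rho p = 1 -> p = oneS R mu nu.
Proof.
move=> Sp r1; have B1 := cayley_height_ge Sp; have := rhoE Sp; rewrite r1 mulr1.
have z0 := dotv_ge0 p.1.2; have x0 := dotv_ge0 p.1.1.
move: B1 x0 z0 Sp; rewrite /carrier/= /cayley_height.
case: p {r1} => [[x z] a]/=.
set X := dotv x x; set Z := dotv z z => B1 x0 z0 a0 E.
have q0 : 0 <= (1 - a) ^+ 2 by exact: sqr_ge0.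
have E' : (1 - a) ^+ 2 + (2 * (1 + a) * (X / 4) + (X / 4) ^+ 2 + Z) = 0.
  by move: E; rewrite [(1 + a + _) ^+ 2]sqrrD; lra.
have h1 : 0 <= 2 * (1 + a) * (X / 4) by rewrite !mulr_ge0//; lra.
have h2 : 0 <= (X / 4) ^+ 2 by exact: sqr_ge0.
have a1 : (1 - a) ^+ 2 = 0 by lra.
have ea : a = 1 by move/eqP: a1; rewrite sqrf_eq0 => /eqP; lra.
have z00 : Z = 0 by lra.
have x00 : X = 0.
  have : 2 * (1 + a) * (X / 4) = 0 by lra.
  by rewrite ea; lra.
by rewrite /oneS ea (dotv_eq0 x00) (dotv_eq0 z00).
Qed.

(** From (1 + a + |x|^2 / 4)^2 + |z|^2 <= 4 a M one reads off a <= 4 M,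
    1 <= 4 a M, |x|^2 <= 16 M and |z| <= 4 M. *)
Lemma rho_bounds M p : S p -> rho p <= M -> generators_le (4 * M) p.
Proof.
move=> Sp rM; have r1 := rho_ge1 Sp; have B1 := cayley_height_ge Sp.
have E := rhoE Sp; have z0 := dotv_ge0 p.1.2; have x0 := dotv_ge0 p.1.1.
have a0 : 0 < p.2 by [].
have M1 : 1 <= M by exact: le_trans rM.
have le : cayley_height p ^+ 2 + dotv p.1.2 p.1.2 <= 4 * p.2 * M.
  by rewrite -E ler_pM2l ?mulr_gt0.
have a4 : p.2 <= 4 * M.
  rewrite -(ler_pM2l a0); nra.
have aV : 1 <= 4 * M * p.2 by nra.
have B4 : cayley_height p <= 4 * M by nra.
have sq u : u ^+ 2 <= (4 * M) ^+ 2 -> `|u| <= 4 * M.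
  have M0 : 0 <= 4 * M by lra.
  by move=> u2; rewrite -[X in _ <= X]ger0_norm// -!sqrtr_sqr ler_wsqrtr.
split.
- move=> l; apply: sq; apply: le_trans (sqr_coord_le_dotv _ _) _.
  have : dotv p.1.1 p.1.1 <= 16 * M by move: B4; rewrite /cayley_height; lra.
  nra.
- move=> k; apply: sq; apply: le_trans (sqr_coord_le_dotv _ _) _.
  have : 0 <= cayley_height p ^+ 2 by exact: sqr_ge0.
  have : 0 <= M * (4 * M - p.2) by rewrite mulr_ge0//; lra.
  by rewrite exprMn expr2; lra.
- rewrite -[X in X <= _]ger0_norm ?sqrtr_ge0//; apply: sq.
  rewrite sqr_sqrtr ?ltW//; nra.
- rewrite -[X in X <= _]ger0_norm ?invr_ge0 ?sqrtr_ge0//; apply: sq.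
  have aV' : p.2^-1 <= 4 * M by rewrite -(ler_pM2r a0) mulVf ?gt_eqF.
  rewrite exprVn sqr_sqrtr ?ltW//; nra.
Qed.

End rho.

(** * Every path is at least as long as arcosh (2 rho - 1) *)

Section lower_bound.
Variables (R : realType) (mu nu : nat) (J : {linear 'rV[R]_nu -> 'M[R]_mu}).
Hypothesis hJ : heisenberg_type J.
Local Notation V := ('rV[R]_mu * 'rV[R]_nu * R)%type.
Local Notation S := (@carrier R mu nu).

Lemma continuous_x (c : R -> V) s l : {for s, continuous c} ->
  {for s, continuous (fun t => (c t).1.1 ord0 l)}.
Proof.
move=> cc.
apply: (@continuous_comp _ _ _ c (fun p : V => p.1.1 ord0 l)); first exact: cc.
by have [d _] := is_diff_x l (c s); exact: differentiable_continuous.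
Qed.

Lemma continuous_z (c : R -> V) s k : {for s, continuous c} ->
  {for s, continuous (fun t => (c t).1.2 ord0 k)}.
Proof.
move=> cc.
apply: (@continuous_comp _ _ _ c (fun p : V => p.1.2 ord0 k)); first exact: cc.
by have [d _] := is_diff_z k (c s); exact: differentiable_continuous.
Qed.

Lemma continuous_height (c : R -> V) s : {for s, continuous c} ->
  {for s, continuous (fun t => (c t).2)}.
Proof.
move=> cc.
apply: (@continuous_comp _ _ _ c (fun p : V => p.2)); first exact: cc.
by have [d _] := is_diff_height (c s); exact: differentiable_continuous.
Qed.

Lemma continuous_sum_fct n (f : 'I_n -> R -> R) s :
  (forall i, {for s, continuous (f i)}) ->
  {for s, continuous (fun t => \sum_i f i t)}.
Proof.
elim: n f => [|n IH] f cf.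
  rewrite (_ : (fun t => _) = cst 0); first exact: cvg_cst.
  by apply/funext => t; rewrite big_ord0.
rewrite (_ : (fun t => _) =
    f ord0 + (fun t => \sum_i f (lift ord0 i) t)); last first.
  by apply/funext => t; rewrite big_ord_recl.
by apply: continuousD; [exact: cf|exact: IH].
Qed.

Lemma continuous_frame_coord (c d : R -> V) s i :
  {for s, continuous c} -> {for s, continuous d} -> S (c s) ->
  {for s, continuous (fun t => frame_coord J (c t) (d t) i)}.
Proof.
move=> cc cd Sc.
have ca : {for s, continuous (fun t => (c t).2)} by exact: continuous_height.
have cd3 : {for s, continuous (fun t => (d t).2)} by exact: continuous_height.
have cx l : {for s, continuous (fun t => (c t).1.1 ord0 l)}.
  exact: continuous_x.
have cdx l : {for s, continuous (fun t => (d t).1.1 ord0 l)}.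
  exact: continuous_x.
have cdz k : {for s, continuous (fun t => (d t).1.2 ord0 k)}.
  exact: continuous_z.
have a0 : (c s).2 != 0 by rewrite gt_eqF.
have s0 : Num.sqrt (c s).2 != 0 by rewrite gt_eqF// sqrtr_gt0.
have cs : {for s, continuous (fun t => Num.sqrt (c t).2)}.
  apply: (@continuous_comp _ _ _ (fun t => (c t).2) Num.sqrt) => //.
  exact: sqrt_continuous.
rewrite (_ : (fun t => _) = fun t => match unlift ord0 i with
  | None => (d t).2 / (c t).2
  | Some j =>
    match fintype.split j with
    | inl l => (d t).1.1 ord0 l / Num.sqrt (c t).2
    | inr k => ((d t).1.2 ord0 k - 2^-1 * \sum_i
        (\sum_j (c t).1.1 ord0 j * (J (delta_mx ord0 k))^T j i) *
        (d t).1.1 ord0 i) / (c t).2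
    end
  end); last first.
  apply/funext => t; rewrite /frame_coord; case: (c t) => [[x z] a] /=.
  case: (unlift _ _) => [j|//]; case: (fintype.split j) => [//|k] /=.
  rewrite mxE /dotv; congr ((_ - _ * _) / _); apply: eq_bigr => m _.
  by rewrite mxE.
case: (unlift _ _) => [j|]; last by apply: cvgM; [exact: cd3|exact: cvgV].
case: (fintype.split j) => k; first by apply: cvgM; [exact: cdx|exact: cvgV].
apply: cvgM; last exact: cvgV.
apply: cvgB; first exact: cdz.
apply: cvgM; first exact: cvg_cst.
apply: continuous_sum_fct => m; apply: cvgM; last exact: cdx.
apply: continuous_sum_fct => m'; apply: cvgM; [exact: cx|exact: cvg_cst].
Qed.

Definition speed (c : R -> V) (s : R) : R :=
  Num.sqrt (metric J (c s) (derive1 c s) (derive1 c s)).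

Lemma continuous_speed (p q : V) (c : R -> V) (s : R) :
  C1_path p q c -> s \in `[0, 1] ->
  {for s, continuous (speed c)}.
Proof.
move=> [_ _ /(_ s)] /[apply] -[Sc].
move=> /derivable1_diffP/differentiable_continuous cc cd.
apply: (@continuous_comp _ _ _
  (fun t => metric J (c t) (derive1 c t) (derive1 c t)) Num.sqrt).
  rewrite /metric; apply: continuous_sum_fct => i.
  by apply: cvgM; exact: continuous_frame_coord.
exact: sqrt_continuous.
Qed.

Lemma within_continuous_speed (p q : V) (c : R -> V) : C1_path p q c ->
  {within `[0, 1], continuous (speed c)}.
Proof.
move=> cP; apply: continuous_in_subspaceT => s /[1!inE] s01.
exact: continuous_speed cP s01.
Qed.

(** The value of cosh at the distance to the identity: see
    [rdist_hyperbolic]. *)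
Definition ucosh (p : V) : R := 2 * rho p - 1.

Lemma ucosh_sqr p : ucosh p ^+ 2 - 1 = 4 * (rho p ^+ 2 - rho p).
Proof. by rewrite /ucosh; ring. Qed.

Lemma ucosh_ge1 p : S p -> 1 <= ucosh p.
Proof. by move=> /rho_ge1; rewrite /ucosh; lra. Qed.

Lemma is_derive_ucosh_path (p q : V) (c : R -> V) (s : R) :
  C1_path p q c -> s \in `[0, 1] ->
  is_derive s 1 (fun t => ucosh (c t))
    (2 * 'D_(derive1 c s) (@rho R mu nu) (c s)).
Proof.
move=> [_ _ /(_ s)] /[apply] -[Sc /derivable1_diffP dc _].
have dr := tame_differentiable (@tame_rho R mu nu) Sc.
have dcomp : is_derive s 1 (@rho R mu nu \o c)
    ('D_(derive1 c s) (@rho R mu nu) (c s)).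
  apply: DeriveDef; first exact/diff_derivable/differentiable_comp.
  rewrite deriveE; last exact: differentiable_comp.
  by rewrite diff_comp// deriveE//= derive1E deriveE.
rewrite (_ : (fun t => _) = 2 \*: (@rho R mu nu \o c) - cst 1)//.
by apply: is_derive_eq; rewrite subr0.
Qed.

Lemma ucosh_speed (p q : V) (c : R -> V) (s : R) :
  C1_path p q c -> s \in `[0, 1] ->
  `|2 * 'D_(derive1 c s) (@rho R mu nu) (c s)| <=
  Num.sqrt (ucosh (c s) ^+ 2 - 1) * speed c s.
Proof.
move=> [_ _ /(_ s)] /[apply] -[Sc _ _].
rewrite -sqrtr_sqr -sqrtrM; last first.
  by rewrite subr_ge0 expr_ge1// ?ucosh_ge1// (le_trans ler01)// ucosh_ge1.
apply: ler_wsqrtr; rewrite exprMn ucosh_sqr.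
have := derive_rho_le hJ (derive1 c s) Sc; lra.
Qed.

(** arcosh u = ln (u + sqrt (u^2 - 1)) is singular at u = 1, the value taken at
    the end of the path; the proof uses ln (u + sqrt (u^2 - 1 + e)), whose
    derivative 1 / sqrt (u^2 - 1 + e) exists for all u >= 1, and lets e tend to
    0. *)
Lemma path_length_ge p c : C1_path p (oneS R mu nu) c ->
  ucosh p + Num.sqrt (ucosh p ^+ 2 - 1) <= expR (path_length J c).
Proof.
move=> cP.
have [c0 c1 cS] := cP.
have Scs s : s \in `[0, 1] -> S (c s) by move=> /cS[].
have Sp : S p by rewrite -c0; apply: Scs; rewrite bound_itvE.
have cv := within_continuous_speed cP.
have iv : lebesgue_measure.-integrable `[(0 : R), 1] (EFin \o speed c).
  by apply: continuous_compact_integrable => //; exact: segment_compact.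
pose F x := parameterized_integral lebesgue_measure 0 x (speed c).
have F0 : F 0 = 0 by rewrite /F /parameterized_integral set_itv1 Rintegral_set1.
have F1 : F 1 = path_length J c by [].
pose L := path_length J c; rewrite -/L.
suff H (e : R) : 0 < e ->
    ucosh p + Num.sqrt (ucosh p ^+ 2 - 1) <= expR L * (1 + Num.sqrt e).
  apply/ler_addgt0Pr => d d0.
  (* With this e the error term expR L * sqrt e is exactly d. *)
  have d2 : 0 < (d / expR L) ^+ 2 by rewrite exprn_gt0 ?divr_gt0 ?expR_gt0.
  have := H _ d2.
  rewrite sqrtr_sqr ger0_norm; last by rewrite divr_ge0 ?expR_ge0 ?ltW.
  by rewrite mulrDr mulr1 [expR L * (d / _)]mulrC divfK// gt_eqF// expR_gt0.
move=> e0.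
pose g (u : R) : R := Num.sqrt (u ^+ 2 - 1 + e).
pose W (u : R) := ln (u + g u).
have g0 u : 1 <= u -> 0 < u ^+ 2 - 1 + e.
  by move=> u1; rewrite ltr_wpDl// subr_ge0 expr_ge1// (le_trans ler01).
have ug0 u : 1 <= u -> 0 < u + g u.
  by move=> u1; rewrite ltr_pwDl ?sqrtr_ge0// (lt_le_trans ltr01).
have dW (u : R) : 1 <= u -> is_derive u 1 W (g u)^-1.
  move=> u1; have gu0 := g0 u u1; have ugu := ug0 u u1.
  have gn : g u != 0 by rewrite gt_eqF// sqrtr_gt0.
  have dg : is_derive u 1 g (u / g u).
    have ds := is_derive1_sqrt gu0.
    have dp : is_derive u 1 (fun u : R => u ^+ 2 - 1 + e) (2 * u).
      rewrite (_ : (fun u => _) = (id : R -> R) ^+ 2 - cst 1 + cst e)//.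
      by apply: is_derive_eq; rewrite subr0 addr0 /GRing.scale/= mulr1 expr1.
    have := @is_derive1_comp _ Num.sqrt
      (fun u : R => u ^+ 2 - 1 + e) u _ _ ds dp.
    rewrite -[_ \o _]/g.
    move=> /is_derive_eq; apply; rewrite -/(g u); field; exact: gn.
  have dl := is_derive1_ln ugu.
  have da : is_derive u 1 (fun u => u + g u) (1 + u / g u).
    exact: (is_deriveD (is_derive_id u 1) dg).
  have := @is_derive1_comp _ (@ln R) (fun u : R => u + g u) u _ _ dl da.
  rewrite -[_ \o _]/W.
  move=> /is_derive_eq; apply; field.
  by rewrite gn/= gt_eqF.
pose w t := W (ucosh (c t)).
have dw (s : R) : s \in `[0, 1] -> is_derive s 1 w
    ((g (ucosh (c s)))^-1 * (2 * 'D_(derive1 c s) (@rho R mu nu) (c s))).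
  move=> s01; have du := is_derive_ucosh_path cP s01.
  have dWs := dW _ (ucosh_ge1 (Scs s s01)).
  exact: (@is_derive1_comp _ W (fun t => ucosh (c t)) s _ _ dWs du).
have dF (s : R) : s \in `]0, 1[ -> is_derive s 1 F (speed c s).
  rewrite in_itv/= => /andP[s0 s1].
  have s01 : s \in `[0, 1] by rewrite in_itv/= !ltW.
  have [d1 d2] := continuous_FTC1_closed s1 iv s0 (continuous_speed cP s01).
  by split; [exact: d1|rewrite -derive1E; exact: d2].
(* F is the length travelled so far, so that it dominates the decrease of w. *)
pose H := F + w.
have dH (s : R) : s \in `]0, 1[ -> is_derive s 1 H (speed c s +
    (g (ucosh (c s)))^-1 * (2 * 'D_(derive1 c s) (@rho R mu nu) (c s))).
  move=> s01; have := dF s s01.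
  have := dw s (subset_itv_oo_cc s01) => ? ?.
  by apply: is_derive_eq.
have H01 : H 0 <= H 1.
  apply: (@ger0_derive1_le_cc _ H 0 1); rewrite ?bound_itvE//.
  - by move=> s /dH[].
  - move=> s s01; have [_ E] := dH s s01; rewrite derive1E E.
    have s01' := subset_itv_oo_cc s01.
    have u1 := ucosh_ge1 (Scs s s01').
    have gp : 0 < g (ucosh (c s)) by rewrite sqrtr_gt0; exact: g0.
    rewrite -(pmulr_rge0 _ gp) mulrDr mulrA divff ?gt_eqF// mul1r.
    have := ucosh_speed cP s01'; set D := 2 * _ => bD.
    have : `|D| <= g (ucosh (c s)) * speed c s.
      apply: le_trans bD _; rewrite ler_wpM2r ?sqrtr_ge0//.
      by apply: ler_wsqrtr; rewrite lerDl ltW.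
    by rewrite ler_norml => /andP[]; lra.
  - move=> s; apply: cvgD.
      exact: (parameterized_integral_continuous ler01 iv).
    apply: derivable_within_continuous => t t01.
    by have [] := dw t t01.
move: H01; rewrite /H !fctE F0 F1 add0r -/L /w c0 c1.
have u1 : ucosh (oneS R mu nu) = 1 by rewrite /ucosh rho_oneS; ring.
rewrite u1 /W.
have e1 : g 1 = Num.sqrt e by rewrite /g expr1n subrr add0r.
rewrite e1 => H01.
have := H01; rewrite -ler_expR expRD !lnK ?posrE; last 2 first.
- by rewrite -e1 ug0.
- by apply: ug0; exact: ucosh_ge1.
apply: le_trans; rewrite lerD2l; apply: ler_wsqrtr.
by rewrite lerDl ltW.
Qed.

End lower_bound.

(** * Geodesics through the identity *)

Section ratio.
Variable R : realType.

Definition ratio (P Q : {poly R}) (s : R) : R := P.[s] / Q.[s].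

Lemma is_derive_ratio (P Q : {poly R}) (s : R) : Q.[s] != 0 ->
  is_derive s 1 (ratio P Q) (ratio (P^`() * Q - P * Q^`()) (Q ^+ 2) s).
Proof.
move=> Q0.
have dQ : is_derive s 1 (fun t => (Q.[t])^-1) (- Q.[s] ^- 2 * Q^`().[s]).
  by apply: DeriveDef; [exact: derivableV|rewrite deriveV// derive_val].
rewrite (_ : ratio P Q = horner P * (fun t => (Q.[t])^-1))//.
apply: is_derive_eq.
rewrite /ratio !hornerE /GRing.scale/=; field; exact: Q0.
Qed.

End ratio.

Section upper_bound.
Variables (R : realType) (mu nu : nat) (J : {linear 'rV[R]_nu -> 'M[R]_mu}).
Hypothesis hJ : heisenberg_type J.
Local Notation V := ('rV[R]_mu * 'rV[R]_nu * R)%type.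
Local Notation S := (@carrier R mu nu).

Lemma metricE p v : S p ->
  let w := v.1.2 - 2^-1 *: bracket J p.1.1 v.1.1 in
  metric J p v v =
  (v.2 / p.2) ^+ 2 + dotv v.1.1 v.1.1 / p.2 + dotv w w / p.2 ^+ 2.
Proof.
move=> Sp w; rewrite /metric sum_frame /frame_coord.
case: p Sp @w => [[x z] a]/= a0; rewrite /carrier/= in a0.
rewrite unlift_none -expr2 /dotv !mulr_suml; congr (_ + _ + _).
  apply: eq_bigr => l _; rewrite liftK split_lshift.
  by rewrite mulf_div -expr2 -(expr2 (Num.sqrt a)) sqr_sqrtr ?ltW.
apply: eq_bigr => k _; rewrite liftK split_rshift.
by rewrite mulf_div -[a * a]expr2 !mxE.
Qed.

Section curve.
Variables (X Y : 'rV[R]_mu) (Z : 'rV[R]_nu).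

Definition curve (f g h a : R -> R) (s : R) : V :=
  (f s *: X + g s *: Y, h s *: Z, a s).

Lemma is_derive_curve (f g h a : R -> R) (s f' g' h' a' : R) :
  is_derive s 1 f f' -> is_derive s 1 g g' -> is_derive s 1 h h' ->
  is_derive s 1 a a' ->
  is_derive s 1 (curve f g h a) (f' *: X + g' *: Y, h' *: Z, a').
Proof.
have D (k : R -> R) k' : is_derive s 1 k k' ->
    differentiable k s /\ 'd k s = ( *:%R^~ k') :> (R -> R).
  move=> [dk Ek]; split; first exact/derivable1_diffP.
  by rewrite diff1E ?derive1E ?Ek//; exact/derivable1_diffP.
move=> /D[df Ef] /D[dg Eg] /D[dh Eh] /D[da Ea].
have d1 : differentiable (fun s => f s *: X + g s *: Y) s.
  by apply: differentiableD; exact: differentiableZl.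
have d2 : differentiable (fun s => h s *: Z) s by exact: differentiableZl.
have d12 : differentiable (fun s => (f s *: X + g s *: Y, h s *: Z)) s.
  exact: differentiable_pair.
have dc : differentiable (curve f g h a) s by exact: differentiable_pair.
have Z1 (k : R -> R) k' (U : normedModType R) (u : U) : differentiable k s ->
    'd k s = ( *:%R^~ k') :> (R -> R) -> 'd (fun s => k s *: u) s 1 = k' *: u.
  move=> dk Ek; apply: (etrans (congr1 (fun F => F 1) (diffZl u dk))).
  by rewrite Ek; congr (_ *: _); exact: mul1r.
apply: DeriveDef; first exact: diff_derivable.
rewrite deriveE// /curve diff_pair// diff_pair//.
rewrite (_ : (fun s => f s *: X + _) =
  (fun s => f s *: X) + (fun s => g s *: Y))//.
rewrite diffD; [|exact: differentiableZl..].
congr (_, _, _).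
- by apply: (congr2 +%R); exact: Z1.
- exact: Z1.
- by rewrite Ea; exact: mul1r.
Qed.

Lemma curve_C1 (Pf Pg Ph Pa Q : {poly R}) (s : R) : Q.[s] != 0 ->
  let c := curve (ratio Pf Q) (ratio Pg Q) (ratio Ph Q) (ratio Pa Q) in
  let D P := ratio (P^`() * Q - P * Q^`()) (Q ^+ 2) in
  [/\ derivable c s 1,
      {for s, continuous (derive1 c)} &
      derive1 c s = curve (D Pf) (D Pg) (D Ph) (D Pa) s].
Proof.
move=> Q0 c D.
have dc (t : R) : Q.[t] != 0 ->
    is_derive t 1 c (curve (D Pf) (D Pg) (D Ph) (D Pa) t).
  by move=> Qt; apply: is_derive_curve; exact: is_derive_ratio.
have Ec (t : R) : Q.[t] != 0 ->
    derive1 c t = curve (D Pf) (D Pg) (D Ph) (D Pa) t.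
  by move=> /dc[_ E]; rewrite derive1E E.
split; [by have [] := dc s Q0| |exact: Ec].
have cD : {for s, continuous (curve (D Pf) (D Pg) (D Ph) (D Pa))}.
  apply/differentiable_continuous/derivable1_diffP.
  have Q20 : (Q ^+ 2).[s] != 0 by rewrite horner_exp expf_neq0.
  pose N P := P^`() * Q - P * Q^`().
  pose D' P :=
    ratio ((N P)^`() * Q ^+ 2 - N P * (Q ^+ 2)^`()) ((Q ^+ 2) ^+ 2) s.
  have [] // : is_derive s 1 (curve (D Pf) (D Pg) (D Ph) (D Pa))
    (D' Pf *: X + D' Pg *: Y, D' Ph *: Z, D' Pa).
  by apply: is_derive_curve; exact: is_derive_ratio.
move: cD; rewrite /prop_for /continuous_at -(Ec s Q0) => cD.
apply: cvg_trans cD.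
apply: near_eq_cvg; near=> t; apply/esym/Ec; near: t.
have := @continuous_horner R Q s.
by move=> /cvgr_neq0; apply.
Unshelve. all: by end_near. Qed.

End curve.

Section ray.
Variables (X : 'rV[R]_mu) (Z : 'rV[R]_nu) (t : R).
Let al := dotv X X.
Let be := dotv Z Z.
Let q := al + be + t ^+ 2.
Let tau : {poly R} := 1 - 'X.
Let chi : {poly R} := (1 - t%:P * tau) ^+ 2 + be%:P * tau ^+ 2.
Let Pf : {poly R} := 2%:P * tau * (1 - t%:P * tau).
Let Pg : {poly R} := 2%:P * tau ^+ 2.
Let Ph : {poly R} := 2%:P * tau.
Let Pa : {poly R} := 1 - q%:P * tau ^+ 2.

(** The inverse Cayley transform sends a point (X, Z, t) of the unit ball to
      (2 ((1 - t) X + J_Z X) / c, 2 Z / c, (1 - |X|^2 - |Z|^2 - t^2) / c)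
    with c = (1 - t)^2 + |Z|^2.  This is the image of the segment
    tau (X, Z, t), run from tau = 1 to tau = 0 so as to end at the identity. *)
Definition ray : R -> V :=
  curve X (Jmap J Z X) Z
    (ratio Pf chi) (ratio Pg chi) (ratio Ph chi) (ratio Pa chi).

Hypothesis q1 : q < 1.

Let al0 : 0 <= al. Proof. exact: dotv_ge0. Qed.
Let be0 : 0 <= be. Proof. exact: dotv_ge0. Qed.

Let tauE s : tau.[s] = 1 - s.
Proof. by rewrite /tau !hornerE. Qed.
Let chiE s : chi.[s] = (1 - t * (1 - s)) ^+ 2 + be * (1 - s) ^+ 2.
Proof. by rewrite /chi !hornerE ?tauE. Qed.
Let chi' s : chi^`().[s] = 2 * t * (1 - t * (1 - s)) - 2 * be * (1 - s).
Proof. by rewrite /chi /tau !poly.derivE !hornerE; ring. Qed.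

Let chi0 s : s \in `[0, 1] -> 0 < chi.[s].
Proof.
rewrite in_itv/= => /andP[s0 s1]; rewrite chiE.
have t1 : t ^+ 2 < 1.
  by apply: le_lt_trans q1; rewrite /q lerDr addr_ge0.
have t2 : t < 1 by nra.
by apply: ltr_wpDr; [rewrite mulr_ge0// sqr_ge0|rewrite exprn_gt0//; nra].
Qed.

Let PaE s : Pa.[s] = 1 - q * (1 - s) ^+ 2.
Proof. by rewrite /Pa !hornerE ?tauE. Qed.

Let Pa0 s : s \in `[0, 1] -> 0 < Pa.[s].
Proof.
rewrite in_itv/= => /andP[s0 s1]; rewrite PaE.
have q0 : 0 <= q by rewrite /q addr_ge0 ?sqr_ge0// addr_ge0.
have s2 : (1 - s) ^+ 2 <= 1 by nra.
by rewrite subr_gt0; apply: le_lt_trans q1; rewrite ler_piMr.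
Qed.

Lemma ray_C1 : C1_path (ray 0) (oneS R mu nu) ray.
Proof.
split; first exact: erefl.
  rewrite /ray /curve /ratio /Pf /Pg /Ph /Pa chiE !hornerE ?tauE subrr.
  rewrite !(mulr0, mul0r, expr0n, subr0, addr0, scale0r, expr1n)/=.
  by rewrite !mulr0 addr0 subr0 divr1 scale0r addr0 divr1.
move=> s s01; have c0 := chi0 s01.
have [d c _] := @curve_C1 X (Jmap J Z X) Z Pf Pg Ph Pa chi s (lt0r_neq0 c0).
split; [|exact: d|exact: c].
apply: (_ : 0 < ratio Pa chi s); apply: divr_gt0 => //; exact: Pa0.
Qed.

(** In the ball model a point at Euclidean distance tau sqrt q from the origin
    moves along its radius with hyperbolic speed 2 sqrt q / (1 - q tau^2). *)
Lemma ray_speed s : s \in `[0, 1] ->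
  speed J ray s = 2 * Num.sqrt q / (1 - q * (1 - s) ^+ 2).
Proof.
move=> s01; have c0 := chi0 s01; have a0 := Pa0 s01.
have q0 : 0 <= q by rewrite /q addr_ge0 ?sqr_ge0// addr_ge0.
have cn0 := lt0r_neq0 c0.
have [_ _ E] := @curve_C1 X (Jmap J Z X) Z Pf Pg Ph Pa chi s cn0.
rewrite PaE in a0; have an0 := lt0r_neq0 a0.
suff M : metric J (ray s) (derive1 ray s) (derive1 ray s) =
    (2 * Num.sqrt q / (1 - q * (1 - s) ^+ 2)) ^+ 2.
  rewrite /speed M sqrtr_sqr ger0_norm// divr_ge0 ?mulr_ge0 ?sqrtr_ge0//.
  exact: ltW.
have [_ _ /(_ s s01)[Ss _ _]] := ray_C1.
rewrite metricE// /ray E {E} /curve /=.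
set f := ratio Pf chi s; set g := ratio Pg chi s.
set f' := ratio (Pf^`() * _ - _) _ s; set g' := ratio (Pg^`() * _ - _) _ s.
set h' := ratio (Ph^`() * _ - _) _ s; set a' := ratio (Pa^`() * _ - _) _ s.
set a := ratio Pa chi s.
have XY : dotv X (Jmap J Z X) = 0 by rewrite dotvC dotv_Jmapxx.
have YY : dotv (Jmap J Z X) (Jmap J Z X) = be * al by exact: dotv_JmapJmap.
have BXY : bracket J X (Jmap J Z X) = al *: Z by exact: bracket_Jmap.
have BYX : bracket J (Jmap J Z X) X = - al *: Z.
  by rewrite bracketC// BXY scaleNr.
have -> : bracket J (f *: X + g *: Jmap J Z X) (f' *: X + g' *: Jmap J Z X) =
    ((f * g' - g * f') * al) *: Z.
  rewrite bracketDl// !bracketDr// !bracketZl !bracketZr !bracketxx//.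
  rewrite BXY BYX !scaler0 add0r addr0 !scalerA -scalerDl; congr (_ *: _); ring.
rewrite scalerA -scalerBl.
rewrite !(dotvDl, dotvDr, dotvZl, dotvZr) [dotv (Jmap _ _ _) X]dotvC XY YY.
rewrite -/al -/be [in RHS]expr_div_n [in RHS]exprMn sqr_sqrtr//.
have Ef : f = 2 * (1 - s) * (1 - t * (1 - s)) / chi.[s].
  by rewrite /f /ratio /Pf !hornerE ?tauE.
have Eg : g = 2 * (1 - s) ^+ 2 / chi.[s].
  by rewrite /g /ratio /Pg !hornerE ?tauE.
have Ea : a = (1 - q * (1 - s) ^+ 2) / chi.[s] by rewrite /a /ratio PaE.
have DE P : ratio (P^`() * chi - P * chi^`()) (chi ^+ 2) s =
    (P^`().[s] * chi.[s] - P.[s] * chi^`().[s]) / chi.[s] ^+ 2.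
  by rewrite /ratio hornerD hornerN horner_exp !hornerM.
have Ef' : f' = ((4 * t * (1 - s) - 2) * chi.[s]
    - 2 * (1 - s) * (1 - t * (1 - s)) * chi^`().[s]) / chi.[s] ^+ 2.
  rewrite /f' DE; congr (_ / _).
  by rewrite /Pf /tau !poly.derivE !hornerE; ring.
have Eg' : g' = (- 4 * (1 - s) * chi.[s]
    - 2 * (1 - s) ^+ 2 * chi^`().[s]) / chi.[s] ^+ 2.
  rewrite /g' DE; congr (_ / _).
  by rewrite /Pg /tau !poly.derivE !hornerE; ring.
have Eh' : h' = (- 2 * chi.[s] - 2 * (1 - s) * chi^`().[s]) / chi.[s] ^+ 2.
  rewrite /h' DE; congr (_ / _).
  by rewrite /Ph /tau !poly.derivE !hornerE; ring.
have Ea' : a' = (2 * q * (1 - s) * chi.[s]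
    - (1 - q * (1 - s) ^+ 2) * chi^`().[s]) / chi.[s] ^+ 2.
  rewrite /a' DE; congr (_ / _).
  by rewrite /Pa /tau !poly.derivE !hornerE; ring.
(* What remains is a rational identity in |X|^2, |Z|^2, t and 1 - s. *)
rewrite Ef Eg Ea Ef' Eg' Eh' Ea' chi'.
rewrite {Ef Eg Ea Ef' Eg' Eh' Ea' f g a f' g' h' a' BXY BYX XY YY}.
move: an0 cn0; rewrite chiE /q.
move: (1 - s) => r; clearbody al be => an0 cn0.
field.
by rewrite cn0 an0.
Qed.

Lemma ray_start : let c := (1 - t) ^+ 2 + be in
  ray 0 = ((2 * (1 - t) / c) *: X + (2 / c) *: Jmap J Z X,
           (2 / c) *: Z, (1 - q) / c).
Proof.
move=> c; have E : chi.[0] = c by rewrite chiE subr0 mulr1 expr1n mulr1.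
have tau0 : tau.[0] = 1 by rewrite tauE subr0.
rewrite /ray /curve /ratio E PaE.
have -> : Pf.[0] = 2 * (1 - t) by rewrite /Pf /tau !hornerE; ring.
have -> : Pg.[0] = 2.
  by rewrite /Pg hornerM horner_exp tau0 hornerC expr1n mulr1.
have -> : Ph.[0] = 2 by rewrite /Ph /tau !hornerE; ring.
by rewrite subr0 expr1n mulr1.
Qed.

Lemma expR_ray_length :
  expR (path_length J ray) = (1 + Num.sqrt q) / (1 - Num.sqrt q).
Proof.
have q0 : 0 <= q by rewrite /q addr_ge0 ?sqr_ge0// addr_ge0.
set w := Num.sqrt q.
have w2 : w ^+ 2 = q by rewrite sqr_sqrtr.
have w0 : 0 <= w by exact: sqrtr_ge0.
have w1 : w < 1 by rewrite -sqrtr1 ltr_sqrt.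
pose v (s : R) : R := 2 * w / (1 - q * (1 - s) ^+ 2).
pose F (s : R) : R := ln (1 - w * (1 - s)) - ln (1 + w * (1 - s)).
have pm (s : R) : s \in `[0, 1] ->
    0 < 1 - w * (1 - s) /\ 0 < 1 + w * (1 - s).
  by rewrite in_itv/= => /andP[s0 s1]; split; nra.
have dF (s : R) : s \in `[0, 1] -> is_derive s 1 F (v s).
  move=> /pm[m p].
  have dm : is_derive s 1 (fun s : R => 1 - w * (1 - s)) w.
    rewrite (_ : (fun s => _) = cst 1 - w \*: (cst 1 - id))//.
    by apply: is_derive_eq; rewrite !sub0r scalerN opprK /GRing.scale/= mulr1.
  have dp : is_derive s 1 (fun s : R => 1 + w * (1 - s)) (- w).
    rewrite (_ : (fun s => _) = cst 1 + w \*: (cst 1 - id))//.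
    by apply: is_derive_eq; rewrite sub0r add0r scalerN /GRing.scale/= mulr1.
  have := @is_derive1_comp _ (@ln R) _ s _ _ (is_derive1_ln m) dm.
  have := @is_derive1_comp _ (@ln R) _ s _ _ (is_derive1_ln p) dp.
  move=> dp' dm'; have := is_deriveB dm' dp'; rewrite -[_ - _]/F.
  move=> /is_derive_eq; apply; rewrite /v -w2.
  have mn := lt0r_neq0 m; have pn := lt0r_neq0 p.
  have mpn : 1 - w ^+ 2 * (1 - s) ^+ 2 != 0.
    rewrite (_ : _ - _ = (1 - w * (1 - s)) * (1 + w * (1 - s))); last by ring.
    by rewrite mulf_neq0.
  by field; rewrite exprMn mn pn mpn.
have cF : {within `[0, 1], continuous F}.
  by apply: derivable_within_continuous => s /dF[].
have cv : {within `[0, 1], continuous v}.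
  apply: continuous_in_subspaceT => s /[1!inE] s01.
  have m := Pa0 s01; rewrite PaE in m.
  apply: cvgM; first exact: cvg_cst.
  apply: cvgV; first exact: lt0r_neq0.
  have -> : (fun s : R => 1 - q * (1 - s) ^+ 2) = horner Pa.
    by apply/funext => s'; rewrite PaE.
  by rewrite -PaE; exact: continuous_horner.
have -> : path_length J ray = \int[lebesgue_measure]_(s in `[0, 1]) v s.
  by apply: eq_Rintegral => s; rewrite inE => /ray_speed.
have [F0 F0' F1'] := (continuous_within_itvP F ltr01).1 cF.
rewrite /Rintegral (continuous_FTC2 ltr01 cv (F := F)); last 2 first.
- by split => // s /subset_itv_oo_cc/dF[].
- by move=> s /subset_itv_oo_cc/dF[_ E]; rewrite derive1E E.
rewrite /= /F subrr subr0 mulr0 !mulr1 subr0 addr0 ln1 subrr sub0r opprB.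
by rewrite expRD expRN !lnK ?posrE//; lra.
Qed.

End ray.

(** The witness (X, Z, t) is the Cayley transform of p, a point of the unit ball
    of squared norm tanh(r/2)^2 = 1 - 1 / rho; D is the squared modulus of its
    denominator. *)
Lemma ray_surjective p : S p -> exists (X : 'rV[R]_mu) (Z : 'rV[R]_nu) (t : R),
  dotv X X + dotv Z Z + t ^+ 2 = 1 - (rho p)^-1 /\ ray X Z t 0 = p.
Proof.
move=> Sp; have a0 := Sp; rewrite /carrier/= in a0.
have r1 := rho_ge1 Sp; have B1 := cayley_height_ge Sp; have E := rhoE Sp.
set B := cayley_height p in B1 E; set a := p.2 in a0 B1 E.
pose D := 4 * a * rho p.
have r0 : rho p != 0 by rewrite gt_eqF//; lra.
have an0 : a != 0 by rewrite gt_eqF.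
have D0 : D != 0 by apply: mulf_neq0 => //; apply: mulf_neq0.
pose x := p.1.1; pose z := p.1.2.
pose X := D^-1 *: (B *: x - Jmap J z x).
pose Z := (2 / D) *: z.
pose t := ((B - 1) ^+ 2 + dotv z z - 1) / D.
have zE : dotv z z = D - B ^+ 2 by rewrite /D E; ring.
have xE : dotv x x = 4 * (B - 1 - a).
  by rewrite /B /cayley_height -/x -/a; field.
have Dq : dotv X X + dotv Z Z + t ^+ 2 = 1 - (rho p)^-1.
  rewrite /X /Z /t !(dotvDl, dotvDr, dotvZl, dotvZr, dotvNl, dotvNr).
  rewrite dotv_JmapJmap// [dotv x (Jmap _ _ _)]dotvC dotv_Jmapxx//.
  rewrite xE zE /D; field.
  by rewrite r0 an0.
exists X, Z, t; split => //.
have ZE : dotv Z Z = 4 * dotv z z / D ^+ 2.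
  by rewrite /Z dotvZl dotvZr; field.
have tE : 1 - t = 2 * B / D by rewrite /t zE; field.
have YE : Jmap J Z X = (2 / D ^+ 2) *: (B *: Jmap J z x + dotv z z *: x).
  rewrite /Z /X JmapZl JmapZr JmapDr JmapZr.
  rewrite -scaleN1r JmapZr JmapK// scaleN1r scaleNr opprK scalerA.
  by congr (_ *: _); field.
have chi4 : (1 - t) ^+ 2 + dotv Z Z = 4 / D by rewrite tE ZE zE; field.
rewrite ray_start chi4 Dq YE tE.
apply: (@etrans _ _ (x, z, a)); last by rewrite /x /z /a -!surjective_pairing.
have c2 : 2 / (4 / D) = D / 2 by field.
congr (_, _, _).
- rewrite zE /X; move: (Jmap J z x) => y; apply/rowP => l.
  by rewrite !mxE; field.
- by apply/rowP => l; rewrite !mxE; field.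
- by rewrite /D; field; rewrite r0 an0.
Qed.

End upper_bound.

Section distance.
Variables (R : realType) (mu nu : nat) (J : {linear 'rV[R]_nu -> 'M[R]_mu}).
Hypothesis hJ : heisenberg_type J.
Local Notation V := ('rV[R]_mu * 'rV[R]_nu * R)%type.
Local Notation S := (@carrier R mu nu).

Theorem expR_rdist p : S p ->
  expR (rdist J p) = ucosh p + Num.sqrt (ucosh p ^+ 2 - 1).
Proof.
move=> Sp; have [X [Z [t [Dq ray0]]]] := ray_surjective hJ Sp.
have r1 := rho_ge1 Sp.
have r0 : 0 < rho p by lra.
have q1 : dotv X X + dotv Z Z + t ^+ 2 < 1.
  by rewrite Dq ltrBlDr ltrDl invr_gt0.
have c1 := ray_C1 J q1; rewrite ray0 in c1.
have cl := expR_ray_length hJ q1; rewrite Dq in cl.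
set w := Num.sqrt _ in cl.
have q0 : 0 <= 1 - (rho p)^-1 by rewrite subr_ge0 invf_le1.
have w2 : w ^+ 2 = 1 - (rho p)^-1 by rewrite sqr_sqrtr.
have w0 : 0 <= w by exact: sqrtr_ge0.
have w1 : w < 1 by rewrite -sqrtr1 ltr_sqrt// ltrBlDr ltrDl invr_gt0.
have rE : rho p = (1 - w ^+ 2)^-1 by rewrite w2 opprB addrCA subrr addr0 invrK.
have n1 : 1 - w ^+ 2 != 0 by rewrite gt_eqF//; nra.
have n2 : 1 - w != 0 by rewrite gt_eqF//; lra.
have u2 : ucosh p ^+ 2 - 1 = (2 * w / (1 - w ^+ 2)) ^+ 2.
  by rewrite ucosh_sqr rE; field.
have uw : ucosh p + Num.sqrt (ucosh p ^+ 2 - 1) = (1 + w) / (1 - w).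
  rewrite u2 sqrtr_sqr ger0_norm; last by rewrite divr_ge0 ?mulr_ge0//; nra.
  by rewrite /ucosh rE; field; rewrite n1 n2.
rewrite uw -cl; congr expR; apply/eqP; rewrite eq_le; apply/andP; split.
  apply: ge_inf; last by eexists; [exact: c1|].
  exists 0 => _ [c _ <-]; apply: Rintegral_ge0 => s _; exact: sqrtr_ge0.
apply: lb_le_inf; first by eexists; exists (ray J X Z t); [exact: c1|].
by move=> _ [c cP <-]; have := path_length_ge hJ cP; rewrite uw -cl ler_expR.
Qed.

End distance.

(** * Derivatives of the profiles (cosh - c)^m *)

Section hyperbolic.
Variable R : realType.

Definition cosh (s : R) : R := (expR s + expR (- s)) / 2.
Definition sinh (s : R) : R := (expR s - expR (- s)) / 2.

Lemma sinh_sqr s : sinh s ^+ 2 = cosh s ^+ 2 - 1.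
Proof.
by rewrite /sinh /cosh expRN; field; rewrite gt_eqF// expR_gt0.
Qed.

Lemma is_derive_expRN (s : R) :
  is_derive s 1 (fun t => expR (- t)) (- expR (- s)).
Proof.
have := @is_derive1_comp R expR (fun t => - t) s _ _
  (is_derive_expR _) (is_deriveNid s 1).
by rewrite mulrN1.
Qed.

Lemma is_derive_cosh (s : R) : is_derive s 1 cosh (sinh s).
Proof.
have d := is_derive_expRN s.
rewrite (_ : cosh = 2^-1 \*: (expR + (fun t => expR (- t)))); last first.
  by apply/funext => t; rewrite /cosh mulrC.
by apply: is_derive_eq; rewrite /sinh mulrC.
Qed.

Lemma is_derive_sinh (s : R) : is_derive s 1 sinh (cosh s).
Proof.
have d := is_derive_expRN s.
rewrite (_ : sinh = 2^-1 \*: (expR - (fun t => expR (- t)))); last first.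
  by apply/funext => t; rewrite /sinh mulrC.
by apply: is_derive_eq; rewrite opprK /cosh mulrC.
Qed.

Lemma sinh_ge s : 0 <= s -> s / 2 <= sinh s.
Proof.
move=> s0; rewrite /sinh ler_pM2r ?invr_gt0//.
have := expR_ge1Dx s; have := expR_gt0 s => e0 e1.
have : expR (- s) <= 1 by rewrite -expR0 ler_expR oppr_le0.
lra.
Qed.

Lemma sinh_le s : 0 <= s -> s <= 1 -> sinh s <= expR 1 * s.
Proof.
move=> s0 s1; rewrite /sinh ler_pdivrMr//.
have e1 : expR s <= expR 1 by rewrite ler_expR.
have e2 := expR_ge1Dx (- s).
have e0 : 1 <= expR 1 :> R by rewrite -expR0 ler_expR.
have h : expR s * (1 - s) <= 1.
  by rewrite -[leRHS](expRxMexpNx_1 s) ler_pM2l ?expR_gt0.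
nra.
Qed.

Lemma cosh_le s : 0 <= s -> s <= 1 -> cosh s <= expR 1.
Proof.
move=> s0 s1; rewrite /cosh ler_pdivrMr//.
have e1 : expR s <= expR 1 by rewrite ler_expR.
have e2 : expR (- s) <= expR 1 by rewrite ler_expR; lra.
lra.
Qed.

(** Polynomials in cosh and sinh: a class closed under derivation, on which
    iterated derivatives are linear. *)
Inductive hyppoly : (R -> R) -> Prop :=
| hyppoly_cst c : hyppoly (cst c)
| hyppoly_cosh : hyppoly cosh
| hyppoly_sinh : hyppoly sinh
| hyppolyD f g : hyppoly f -> hyppoly g -> hyppoly (f + g)
| hyppolyM f g : hyppoly f -> hyppoly g -> hyppoly (f * g).

Lemma hyppoly_is_derive f : hyppoly f ->
  exists2 g, hyppoly g & forall s : R, is_derive s 1 f (g s).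
Proof.
elim.
- move=> c; exists (cst 0); first exact: hyppoly_cst.
  by move=> s; exact: is_derive_cst.
- by exists sinh; [exact: hyppoly_sinh|exact: is_derive_cosh].
- by exists cosh; [exact: hyppoly_cosh|exact: is_derive_sinh].
- move=> {}f g hf [f' hf' df] hg [g' hg' dg].
  by exists (f' + g'); [exact: hyppolyD|move=> s; exact: is_deriveD].
- move=> {}f g hf [f' hf' df] hg [g' hg' dg].
  exists (f * g' + g * f'); first by apply: hyppolyD; exact: hyppolyM.
  by move=> s; exact: is_deriveM.
Qed.

Lemma hyppoly_derive1 f : hyppoly f -> hyppoly (derive1 f).
Proof.
move=> /hyppoly_is_derive[g hg dg]; rewrite (_ : derive1 f = g)//.
by apply/funext => s; rewrite derive1E; have [_ ->] := dg s.
Qed.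

Lemma hyppoly_derivable f (s : R) : hyppoly f -> derivable f s 1.
Proof. by move=> /hyppoly_is_derive[g _ /(_ s)[]]. Qed.

Lemma derive1n_hyppolyD n f g : hyppoly f -> hyppoly g ->
  derive1n n (f + g) = derive1n n f + derive1n n g.
Proof.
elim: n f g => [//|n IH] f g hf hg; rewrite !derive1Sn.
rewrite -IH; [|exact: hyppoly_derive1..]; congr derive1n.
apply/funext => s; rewrite derive1E.
by rewrite deriveD; [rewrite -!derive1E|exact: hyppoly_derivable..].
Qed.

Lemma derive1n_hyppolyZ n c f : hyppoly f ->
  derive1n n (cst c * f) = cst c * derive1n n f.
Proof.
elim: n f => [//|n IH] f hf; rewrite !derive1Sn.
rewrite -IH; last exact: hyppoly_derive1.
congr derive1n; apply/funext => s; rewrite derive1E.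
rewrite deriveM; last 2 first.
- exact: hyppoly_derivable (hyppoly_cst c).
- exact: hyppoly_derivable.
by rewrite derive_cst scaler0 addr0 -derive1E.
Qed.

Lemma hyppolyX f n : hyppoly f -> hyppoly (f ^+ n).
Proof.
move=> hf; elim: n => [|n IH]; first exact: hyppoly_cst.
by rewrite exprS; exact: hyppolyM.
Qed.

Definition profile (c : R) (m : nat) : R -> R := (cosh + cst (- c)) ^+ m.

Lemma hyppoly_profile c m : hyppoly (profile c m).
Proof.
by apply/hyppolyX/hyppolyD; [exact: hyppoly_cosh|exact: hyppoly_cst].
Qed.

Lemma profileE c m s : profile c m s = (cosh s - c) ^+ m.
Proof. by rewrite /profile; elim: m => [//|m IH]; rewrite !exprS fctE IH. Qed.

Lemma derive1_profile c m :
  derive1 (profile c m) = cst m%:R * (profile c m.-1 * sinh).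
Proof.
apply/funext => s; have d := is_derive_cosh s.
rewrite derive1E /profile derive_val.
rewrite -[RHS]/(m%:R * (profile c m.-1 s * sinh s)) profileE subr0.
by rewrite mulrA.
Qed.

(** Writing f = cosh - c, one has sinh^2 = f^2 + 2 c f + c^2 - 1, so that
    the second derivative of f^m is a combination of f^m, f^(m-1) and f^(m-2)
    with constant coefficients.  For m <= 1 the truncated predecessors are
    harmless, their coefficients being 0. *)
Lemma derive1n_profile_2 c m : derive1n 2 (profile c m) =
  cst (m%:R ^+ 2) * profile c m +
  (cst (m%:R * (2 * m%:R - 1) * c) * profile c m.-1 +
   cst (m%:R * (m%:R - 1) * (c ^+ 2 - 1)) * profile c m.-2).
Proof.
rewrite derive1Sn derive1n1 derive1_profile.
have h := hyppoly_profile c m.-1.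
have E : derive1 (cst m%:R * (profile c m.-1 * sinh)) = cst m%:R *
    (profile c m.-1 * cosh + sinh * (cst m.-1%:R * (profile c m.-2 * sinh))).
  apply/funext => s; have ds := is_derive_sinh s.
  have dp : is_derive s 1 (profile c m.-1)
      ((cst m.-1%:R * (profile c m.-2 * sinh)) s).
    rewrite -derive1_profile; apply: DeriveDef; first exact: hyppoly_derivable.
    by rewrite derive1E.
  by rewrite derive1E derive_val scaler0 addr0.
rewrite E; apply/funext => s; rewrite !fctE !profileE.
have S2 := sinh_sqr s.
case: m h E => [|[|m]] _ _ /=.
- by rewrite !mul0r expr0n/= !mul0r !addr0.
- by rewrite !expr0 expr1 subrr; ring.
- rewrite [sinh s * _]mulrCA [sinh s * _]mulrCA -expr2 S2.
  rewrite (exprS _ m.+1) (exprS _ m).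
  by rewrite -!natr1; ring.
Qed.

Section at_point.
Variable s : R.
Let d m j := derive1n j (profile (cosh s) m) s.

Lemma derive1n_profile_0 m : d m 0 = (m == 0%N)%:R.
Proof. by rewrite /d derive1n0 profileE subrr expr0n. Qed.

Lemma derive1n_profile_1 m : d m 1 = (m == 1%N)%:R * sinh s.
Proof.
rewrite /d derive1n1 derive1_profile !fctE profileE subrr expr0n.
by case: m => [|[|m]] /=; rewrite ?mul0r ?mulr0 ?mul1r.
Qed.

Lemma derive1n_profile_rec m j : d m j.+2 =
  m%:R ^+ 2 * d m j + (m%:R * (2 * m%:R - 1) * cosh s * d m.-1 j
   + m%:R * (m%:R - 1) * sinh s ^+ 2 * d m.-2 j).
Proof.
have D : derive1n j.+2 (profile (cosh s) m) =
    derive1n j (derive1n 2 (profile (cosh s) m)).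
  by rewrite !derive1Sn derive1n0.
rewrite /d D derive1n_profile_2 sinh_sqr.
have hc m' a : hyppoly (cst a * profile (cosh s) m').
  by apply: hyppolyM; [exact: hyppoly_cst|exact: hyppoly_profile].
rewrite !derive1n_hyppolyD; [|exact: hc|exact: hc|exact: hc|by apply: hyppolyD].
by rewrite !derive1n_hyppolyZ//; exact: hyppoly_profile.
Qed.

Lemma derive1n_profile_lt m j : (j < m)%N -> d m j = 0.
Proof.
have [n] := ubnP j; elim: n j m => // n IH [|[|j]] m jn jm.
- by rewrite derive1n_profile_0 gtn_eqF.
- by rewrite derive1n_profile_1 gtn_eqF// mul0r.
- rewrite derive1n_profile_rec !IH ?mulr0 ?addr0//; lia.
Qed.

Lemma derive1n_profile_diag m : d m m = m`!%:R * sinh s ^+ m.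
Proof.
have [n] := ubnP m; elim: n m => // n IH [|[|m]] mn.
- by rewrite derive1n_profile_0 mul1r.
- by rewrite derive1n_profile_1 expr1.
- have z2 : d m.+2 m = 0 by apply: derive1n_profile_lt; lia.
  have z1 : d m.+1 m = 0 by apply: derive1n_profile_lt; lia.
  have Im : d m m = m`!%:R * sinh s ^+ m by apply: IH; lia.
  by rewrite derive1n_profile_rec/= z2 z1 Im !factS !natrM !exprS -!natr1; ring.
Qed.

End at_point.

Lemma exprz_le1_antimono (s : R) (i j : int) : 0 < s -> s <= 1 -> i <= j ->
  s ^ j <= s ^ i.
Proof.
move=> s0 s1 ij; have [k ->] : exists k : nat, j = i + k%:Z.
  by exists `|j - i|%N; lia.
rewrite expfzDr ?gt_eqF// ler_piMr//; first by apply: exprz_ge0; exact: ltW.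
by apply: exprn_ile1 => //; exact: ltW.
Qed.

(** The function cosh - cosh s vanishes at s with derivative sinh s = O(s), so
    it has order two in s.  In the recursion the factor sinh s ^ 2 makes up for
    the loss of two powers of the function. *)
Lemma derive1n_profile_le j m : exists C : R, forall s, 0 < s -> s <= 1 ->
  `|derive1n j (profile (cosh s) m) s| <= C * s ^ ((2 * m)%:Z - j%:Z).
Proof.
have [n] := ubnP j; elim: n j m => // n IH [|[|j]] m jn.
- exists 1 => s s0 s1; rewrite derive1n_profile_0; case: m => [|m] /=.
    by rewrite normr1 muln0 subr0 expr0z mul1r.
  by rewrite normr0 mul1r exprz_ge0// ltW.
- exists (expR 1) => s s0 s1; rewrite derive1n_profile_1.
  have sh0 := sinh_ge (ltW s0).
  case: eqP => [->|_]; last first.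
    by rewrite mul0r normr0 mulr_ge0 ?expR_ge0// exprz_ge0// ltW.
  rewrite mul1r ger0_norm; last by apply: le_trans sh0; lra.
  by apply: sinh_le => //; exact: ltW.
- have [C1 H1] : exists C : R, forall s, 0 < s -> s <= 1 ->
    `|derive1n j (profile (cosh s) m) s| <= C * s ^ ((2 * m)%:Z - j%:Z).
    by apply: IH; lia.
  have [C2 H2] : exists C : R, forall s, 0 < s -> s <= 1 ->
    `|derive1n j (profile (cosh s) m.-1) s| <= C * s ^ ((2 * m.-1)%:Z - j%:Z).
    by apply: IH; lia.
  have [C3 H3] : exists C : R, forall s, 0 < s -> s <= 1 ->
    `|derive1n j (profile (cosh s) m.-2) s| <= C * s ^ ((2 * m.-2)%:Z - j%:Z).
    by apply: IH; lia.
  pose a : R := m%:R ^+ 2; pose b : R := m%:R * (2 * m%:R - 1) * expR 1.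
  pose c : R := m%:R * (m%:R - 1) * expR 1 ^+ 2.
  exists (`|a| * `|C1| + (`|b| * `|C2| + `|c| * `|C3|)) => s s0 s1.
  have sn0 : s != 0 by rewrite gt_eqF.
  have E : (2 * m)%:Z - j%:Z - 2 = (2 * m)%:Z - j.+2%:Z by lia.
  have bound x (C : R) : `|x| <= C * s ^ ((2 * m)%:Z - j.+2%:Z) ->
      `|x| <= `|C| * s ^ ((2 * m)%:Z - j.+2%:Z).
    move=> xC; apply: (le_trans xC); apply: ler_wpM2r (ler_norm C).
    by apply: exprz_ge0; exact: ltW.
  have e0 : 0 <= expR 1 :> R by exact: expR_ge0.
  have ss : sinh s ^+ 2 <= expR 1 ^+ 2 * s ^+ 2.
    have sh0 : 0 <= sinh s by apply: le_trans (sinh_ge (ltW s0)); lra.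
    have sh1 := sinh_le (ltW s0) s1.
    by rewrite -exprMn lerXn2r ?nnegrE// (le_trans sh0).
  have cc : `|cosh s| <= expR 1.
    rewrite ger0_norm; first by apply: cosh_le => //; exact: ltW.
    by rewrite /cosh divr_ge0 ?addr_ge0 ?expR_ge0.
  have ex (i : int) : 0 <= s ^ i by apply: exprz_ge0; exact: ltW.
  rewrite derive1n_profile_rec [leRHS]mulrDl [X in _ <= _ + X]mulrDl.
  apply: (le_trans (ler_normD _ _)); apply: lerD.
    rewrite normrM -[leRHS]mulrA ler_wpM2l//.
    apply: (le_trans (H1 s s0 s1)).
    apply: (le_trans (ler_wpM2r (ex _) (ler_norm _))).
    by apply: ler_wpM2l => //; apply: exprz_le1_antimono => //; lia.
  apply: (le_trans (ler_normD _ _)); apply: lerD.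
    rewrite /b; case: m {H1 H3 E a b c} H2 bound => [|m] H2 bound.
      by rewrite !mul0r normr0 !mul0r.
    rewrite normrM -[leRHS]mulrA ler_pM//.
      by rewrite normrM [leRHS]normrM ler_wpM2l// (ger0_norm e0).
    apply: bound; rewrite (_ : _ - _ = (2 * m)%:Z - j%:Z); last by lia.
    exact: H2.
  rewrite /c; case: m {H1 H2 E a b c} H3 bound => [|[|m]] H3 bound.
  - by rewrite !mul0r normr0 !mul0r.
  - by rewrite subrr mulr0 !mul0r normr0 !mul0r.
  have -> : `|m.+2%:R * (m.+2%:R - 1) * expR 1 ^+ 2| * `|C3| *
        s ^ ((2 * m.+2)%:Z - j.+2%:Z) =
      `|m.+2%:R * (m.+2%:R - 1)| * (expR 1 ^+ 2 * s ^+ 2) *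
        (`|C3| * s ^ ((2 * m)%:Z - j%:Z)).
    rewrite normrM [`|expR _ ^+ _|]ger0_norm ?exprn_ge0//.
    have -> : (2 * m.+2)%:Z - j.+2%:Z = 2%:Z + ((2 * m)%:Z - j%:Z) by lia.
    rewrite expfzDr// -exprnP; ring.
  rewrite normrM ler_pM//.
    by rewrite normrM ler_wpM2l// ger0_norm ?sqr_ge0.
  apply: (le_trans (H3 s s0 s1)); exact: ler_wpM2r (ler_norm _).
Qed.

End hyperbolic.

(** * The coefficients sigma near the identity *)

Section sigma.
Variables (R : realType) (mu nu : nat) (J : {linear 'rV[R]_nu -> 'M[R]_mu}).
Hypothesis hJ : heisenberg_type J.
Local Notation V := ('rV[R]_mu * 'rV[R]_nu * R)%type.
Local Notation S := (@carrier R mu nu).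
Local Notation r := (rdist J).

Lemma rdist_hyperbolic p : S p ->
  [/\ 0 <= r p, cosh (r p) = ucosh p &
      sinh (r p) = Num.sqrt (ucosh p ^+ 2 - 1)].
Proof.
move=> Sp; have E := expR_rdist hJ Sp; have u1 := ucosh_ge1 Sp.
set w := Num.sqrt _ in E *.
have w0 : 0 <= w by exact: sqrtr_ge0.
have w2 : w ^+ 2 = ucosh p ^+ 2 - 1 by rewrite sqr_sqrtr//; nra.
have y0 : ucosh p + w != 0 by rewrite gt_eqF//; lra.
have yV : (ucosh p + w)^-1 = ucosh p - w.
  apply: (mulfI y0); rewrite divff//.
  by rewrite [RHS]mulrC -subr_sqr w2; ring.
split.
- by rewrite -ler_expR expR0 E; lra.
- by rewrite /cosh expRN E yV; field.
- by rewrite /sinh expRN E yV; field.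
Qed.

Lemma rdist_gt0 p : S p -> p <> oneS R mu nu -> 0 < r p.
Proof.
move=> Sp pn1; have [r0 c _] := rdist_hyperbolic Sp.
rewrite lt_def r0 andbT; apply/eqP => r00; apply: pn1.
apply: rho_eq1 => //; move: c; rewrite r00 /cosh oppr0 expR0 /ucosh; lra.
Qed.

Lemma tame_ucosh : tame (@ucosh R mu nu).
Proof.
have := tameD (tameM (tame_cst 2) (@tame_rho R mu nu)) (tame_cst (- 1)).
exact.
Qed.

Lemma Xder_ucosh_le p i : S p ->
  `|Xder J i (@ucosh R mu nu) p| <= sinh (r p).
Proof.
move=> Sp; have [_ _ ->] := rdist_hyperbolic Sp.
have tr := @tame_rho R mu nu.
have -> : Xder J i (@ucosh R mu nu) p = 2 * 'D_(frame J p i) (@rho R mu nu) p.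
  rewrite /Xder (_ : @ucosh R mu nu = fun q => 2 * rho q + (- 1))//.
  rewrite derive_tameD//; [|exact: tameM (tame_cst 2) tr|exact: tame_cst].
  rewrite derive_tameM//; last exact: tame_cst.
  rewrite [X in X * _](_ : _ = 0) ?mul0r ?add0r; last first.
    exact: (derive_cst (2 : R)).
  by rewrite [X in _ + X](_ : _ = 0) ?addr0//; exact: (derive_cst (- 1 : R)).
rewrite -sqrtr_sqr; apply: ler_wsqrtr; rewrite exprMn ucosh_sqr.
have := derive_rho_le hJ (frame J p i) Sp.
by rewrite metric_frame// eqxx mulr1; lra.
Qed.

(** No field: the value at p is 0.  One field: at most sinh (r p) = O(r p), by
    the eikonal equation.  More fields: bounded, the ball of radius 1 being a
    set where the generators are. *)
Lemma ucosh_has_order K : exists C : R, forall p, S p -> 0 < r p -> r p <= 1 ->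
  has_order J (r p) K 2 C (fun q => ucosh q - ucosh p) p.
Proof.
pose B := [set p : V | S p /\ r p <= 1].
pose M : R := (expR 1 + 1) / 2.
have [C H] : exists C, forall I p, (size I <= K)%N -> B p ->
    `|XJ J I (@ucosh R mu nu) p| <= C.
  apply: (@XJ_bounded _ _ _ J B (4 * M)); last exact: tame_ucosh.
  - by move=> p [].
  - move=> p [Sp rp]; apply: rho_bounds => //.
    have [r0 c _] := rdist_hyperbolic Sp.
    by have := cosh_le r0 rp; rewrite c /ucosh /M; lra.
exists (`|C| + expR 1) => p Sp r0 r1 I sI.
have e0 : 0 < expR 1 :> R by exact: expR_gt0.
have tc : tame (fun _ : V => - ucosh p) by exact: tame_cst.
rewrite (XJD _ _ tame_ucosh tc)// XJ_cst//.
case: I sI => [|i [|i' I]] sI /=.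
- have C0 : 0 <= `|C| + expR 1 by rewrite addr_ge0// ltW.
  by rewrite subrr normr0 mulr_ge0// ltW// exprz_gt0.
- rewrite addr0; apply: (le_trans (Xder_ucosh_le i Sp)).
  have := sinh_le (ltW r0) r1.
  rewrite (_ : 2 - 1%:Z = 1) // expr1z.
  have : 0 <= `|C| by []; nra.
- rewrite addr0; apply: (le_trans (H [:: i, i' & I] p sI _)) => //.
  apply: (@le_trans _ _ (`|C| + expR 1)).
    by apply: (le_trans (ler_norm C)); rewrite lerDl ltW.
  apply: ler_peMr; first by rewrite addr_ge0// ltW.
  rewrite -[X in X <= _](expr0z (r p)); apply: exprz_le1_antimono => //.
  by rewrite subr_le0; lia.
Qed.

Lemma radial_coefs_profile I sigma p m : radial_coefs J I sigma ->
  S p -> p <> oneS R mu nu ->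
  XJ J I (fun q => (ucosh q - ucosh p) ^+ m) p =
  \sum_(1 <= j < (size I).+1)
     derive1n j (profile (cosh (r p)) m) (r p) * sigma j p.
Proof.
move=> Hs Sp pn1; apply: Hs => //.
  apply: tame_smooth; apply: tameX.
  by apply: tameD; [exact: tame_ucosh|exact: tame_cst].
move=> q Sq; rewrite profileE.
by have [_ -> _] := rdist_hyperbolic Sq; have [_ -> _] := rdist_hyperbolic Sp.
Qed.

(** Downward induction on m: the row of index m of the triangular system
    determines sigma_m from the sigma_j with j > m, the diagonal entry
    m! (sinh s)^m being at least (s / 2)^m. *)
Lemma sigma_le k : exists2 C : R, 0 <= C & forall I sigma, size I = k ->
  radial_coefs J I sigma -> forall p, S p -> p <> oneS R mu nu -> r p <= 1 ->
  forall m, (0 < m)%N -> (m <= k)%N -> `|sigma m p| <= C * r p ^ (m%:Z - k%:Z).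
Proof.
suff H n : exists2 C : R, 0 <= C & forall I sigma, size I = k ->
    radial_coefs J I sigma -> forall p, S p -> p <> oneS R mu nu -> r p <= 1 ->
    forall m, (0 < m)%N -> (m <= k)%N -> (k < m + n)%N ->
    `|sigma m p| <= C * r p ^ (m%:Z - k%:Z).
  have [C C0 HC] := H k.+1; exists C => // I sigma sI Hs p Sp pn1 r1 m m0 mk.
  by apply: (HC I) => //; lia.
elim: n => [|n [C C0 HC]].
  by exists 0 => // I sigma sI Hs p Sp pn1 r1 m m0 mk; lia.
pose m := (k - n)%N.
have [Co Ho] := ucosh_has_order k.
have Hb : forall j, exists C : R, forall s, 0 < s -> s <= 1 ->
  `|derive1n j (profile (cosh s) m) s| <= C * s ^ ((2 * m)%:Z - j%:Z).
  by move=> j; exact: derive1n_profile_le.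
pose D j := projT1 (cid (Hb j)).
have HD j s : 0 < s -> s <= 1 ->
    `|derive1n j (profile (cosh s) m) s| <= D j * s ^ ((2 * m)%:Z - j%:Z).
  by rewrite /D; case: cid => /= x; exact.
pose A := (2 ^+ k * Co) ^+ m; pose T := \sum_(m.+1 <= j < k.+1) `|D j| * C.
have T0 : 0 <= T by apply: sumr_ge0 => j _; rewrite mulr_ge0.
exists (C + (`|A| + T) * 2 ^+ m).
  by rewrite addr_ge0// mulr_ge0 ?addr_ge0// exprn_ge0.
move=> I sigma sI Hs p Sp pn1 r1 m' m'0 m'k km'.
have r0 := rdist_gt0 Sp pn1.
have rn0 : r p != 0 by rewrite gt_eqF.
have ex i : 0 <= r p ^ i by apply: exprz_ge0; exact: ltW.
have [km|km] := ltnP k (m' + n).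
  apply: (le_trans (HC I _ sI Hs p Sp pn1 r1 _ m'0 m'k km)).
  apply: ler_wpM2r => //.
  by rewrite lerDl mulr_ge0 ?addr_ge0// exprn_ge0.
have Em : m' = m by rewrite /m; lia.
subst m'.
have E := radial_coefs_profile m Hs Sp pn1.
have := has_orderX m r0 (tameD tame_ucosh (tame_cst (- ucosh p))) Sp
  (Ho p Sp r0 r1).
move=> /(_ I); rewrite sI leqnn => /(_ isT); rewrite E sI -/A.
rewrite (big_cat_nat (n := m)) //=; last exact: leqW.
rewrite big_nat_cond big1 ?add0r; last first.
  by move=> j /andP[/andP[_ jm] _]; rewrite derive1n_profile_lt// mul0r.
rewrite big_ltn// derive1n_profile_diag => HX.
have mn : (k <= m + n)%N by rewrite /m; lia.
set s := r p in HX r0 r1 rn0 ex *.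
have tail : `|\sum_(m.+1 <= j < k.+1)
      derive1n j (profile (cosh s) m) s * sigma j p| <=
    T * s ^ ((2 * m)%:Z - k%:Z).
  apply: (le_trans (ler_norm_sum _ _ _)); rewrite /T mulr_suml.
  apply: ler_sum_nat => j /andP[mj jk]; rewrite normrM.
  have -> : `|D j| * C * s ^ ((2 * m)%:Z - k%:Z) =
      `|D j| * s ^ ((2 * m)%:Z - j%:Z) * (C * s ^ (j%:Z - k%:Z)).
    have e : (2 * m)%:Z - k%:Z = ((2 * m)%:Z - j%:Z) + (j%:Z - k%:Z).
      by rewrite addrA subrK.
    by rewrite e expfzDr// mulrACA.
  apply: ler_pM => //; last first.
    have j0 : (0 < j)%N by exact: leq_ltn_trans mj.
    have jn : (k < j + n)%N by apply: (leq_ltn_trans mn); rewrite ltn_add2r.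
    exact: (HC I _ sI Hs p Sp pn1 r1 j j0 jk jn).
  by apply: (le_trans (HD j s r0 r1)); exact: ler_wpM2r (ler_norm _).
have sm : s ^+ m / 2 ^+ m <= m`!%:R * sinh s ^+ m.
  rewrite -expr_div_n.
  have s2 : 0 <= s / 2 by rewrite divr_ge0// ltW.
  have h := sinh_ge (ltW r0).
  apply: (@le_trans _ _ (sinh s ^+ m)).
    by rewrite lerXn2r// nnegrE// (le_trans s2).
  by rewrite ler_peMl ?exprn_ge0 ?(le_trans s2)// ler1n fact_gt0.
have sm0 : 0 < s ^+ m / 2 ^+ m by rewrite divr_gt0 ?exprn_gt0.
have main : `|sigma m p| * (s ^+ m / 2 ^+ m) <=
    (`|A| + T) * s ^ ((2 * m)%:Z - k%:Z).
  apply: (@le_trans _ _ `|m`!%:R * sinh s ^+ m * sigma m p|).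
    rewrite normrM mulrC ler_wpM2r//; apply: (le_trans sm); exact: ler_norm.
  rewrite mulrDl; set X := _ * sigma m p in HX *.
  set Y := \sum_(_ <= _ < _) _ in HX tail.
  have -> : X = (X + Y) - Y by rewrite addrK.
  apply: (le_trans (ler_normB _ _)); apply: lerD => //.
  apply: (le_trans HX); exact: ler_wpM2r (ler_norm _).
rewrite -(ler_pM2r sm0); apply: (le_trans main).
have -> : (C + (`|A| + T) * 2 ^+ m) * s ^ (m%:Z - k%:Z) * (s ^+ m / 2 ^+ m) =
    (C / 2 ^+ m + (`|A| + T)) * s ^ ((2 * m)%:Z - k%:Z).
  have e : (2 * m)%:Z - k%:Z = (m%:Z - k%:Z) + m%:Z.
    by rewrite addrAC -PoszD addnn mul2n.
  rewrite [in RHS]e [X in _ = _ * X]expfzDr// -[s ^ m%:Z]/(s ^+ m).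
  have : 2 ^+ m != 0 :> R by rewrite expf_neq0.
  by move: (2 ^+ m) (s ^+ m) (s ^ _) => u v w u0; field.
by apply: ler_wpM2r => //; rewrite lerDr divr_ge0 ?exprn_ge0.
Qed.

End sigma.

(** * Upsilon, Xi and the expansion of X_I h *)

Section identities.
Variable R : realType.
Implicit Types (F Y hh e : nat -> R).

Lemma big_nat_odd_even F m : \sum_(1 <= i < (2 * m).+2) F i =
  \sum_(0 <= j < m.+1) F (2 * j + 1)%N + \sum_(1 <= j < m.+1) F (2 * j)%N.
Proof.
elim: m => [|m IH]; first by rewrite !big_nat1 [X in _ + X]big_geq// addr0.
have -> : (2 * m.+1).+2 = (2 * m).+4 by lia.
rewrite big_nat_recr//= big_nat_recr//= IH [in RHS]big_nat_recr//=.
rewrite [X in _ = _ + X]big_nat_recr//= -!addrA; congr (_ + _).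
rewrite [RHS]addrCA; congr (_ + _); rewrite addrC; congr (F _ + F _); lia.
Qed.

(** The sum defining Phi, with consecutive terms grouped in pairs; e i stands
    for r^i / i! and hh i for the i-th derivative of the heat kernel. *)
Definition alternating_taylor (hh e : nat -> R) (n l : nat) : R :=
  \sum_(0 <= i < n) (e (2 * i)%N * hh (2 * l + 2 * i).+1
                     - e (2 * i).+1 * hh (2 * l + 2 * i).+2).

(** Induction on m: passing from m to m + 1 adds to the coefficient of each Y l
    one even term, coming from the sigma of odd index 2m + 1, and one odd term,
    coming from the sigma of even index 2m + 2.  These two form the last pair of
    [alternating_taylor]. *)
Lemma sum_alternating_taylor hh e Y m : e 0%N = 1 ->
  \sum_(0 <= j < m) hh (2 * j + 1)%N *
    (Y j + \sum_(0 <= l < j) e (2 * j - 2 * l)%N * Y l) -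
  \sum_(1 <= j < m.+1) hh (2 * j)%N *
    (\sum_(0 <= l < j) e (2 * j - 2 * l - 1)%N * Y l) =
  \sum_(0 <= l < m) alternating_taylor hh e (m - l) l * Y l.
Proof.
move=> e0; elim: m => [|m IH]; first by rewrite !big_geq// subr0.
rewrite [in RHS]big_nat_recr//= subSnn.
have -> : alternating_taylor hh e 1 m = hh (2 * m).+1 - e 1%N * hh (2 * m).+2.
  by rewrite /alternating_taylor big_nat1 muln0 addn0 e0 mul1r.
have -> : \sum_(0 <= l < m) alternating_taylor hh e (m.+1 - l) l * Y l =
    \sum_(0 <= l < m) alternating_taylor hh e (m - l) l * Y l +
    (hh (2 * m).+1 * \sum_(0 <= l < m) e (2 * m - 2 * l)%N * Y l
     - hh (2 * m).+2 * \sum_(0 <= l < m) e (2 * m - 2 * l).+1 * Y l).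
  rewrite !mulr_sumr -sumrB -big_split; apply: eq_big_nat => l /andP[_ lm] /=.
  rewrite subSn; last exact: ltnW.
  rewrite {1}/alternating_taylor big_nat_recr//=.
  rewrite -/(alternating_taylor hh e (m - l) l).
  have -> : (2 * (m - l) = 2 * m - 2 * l)%N by lia.
  have -> : (2 * l + (2 * m - 2 * l) = 2 * m)%N by lia.
  ring.
rewrite -IH big_nat_recr//= [X in _ - X = _]big_nat_recr//=.
rewrite [\sum_(0 <= l < m.+1) _]big_nat_recr//=.
have -> : (2 * m + 1 = (2 * m).+1)%N by lia.
have -> : (2 * m.+1 = (2 * m).+2)%N by lia.
have -> : ((2 * m).+2 - 2 * m - 1 = 1)%N by lia.
have -> : \sum_(0 <= l < m) e ((2 * m).+2 - 2 * l - 1)%N * Y l =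
    \sum_(0 <= l < m) e (2 * m - 2 * l).+1 * Y l.
  by apply: eq_big_nat => l /andP[_ lm]; congr (e _ * _); lia.
ring.
Qed.

Lemma big_nat_pairs F n : \sum_(0 <= i < 2 * n) F i =
  \sum_(0 <= i < n) (F (2 * i)%N + F (2 * i).+1).
Proof.
elim: n => [|n IH]; first by rewrite !big_geq.
have -> : (2 * n.+1 = (2 * n).+2)%N by lia.
by rewrite big_nat_recr//= big_nat_recr//= IH [in RHS]big_nat_recr//= addrA.
Qed.

Lemma Phi_alternating_taylor (G : R -> R) (s : R) n l : (0 < n)%N ->
  Phi G (2 * n) (2 * l) s =
  alternating_taylor (fun i => derive1n i G s) (fun i => s ^+ i / i`!%:R) n l.
Proof.
move=> n0; rewrite /Phi ifF; last by apply/eqP; lia.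
rewrite /alternating_taylor.
rewrite big_nat_pairs; apply: eq_big_nat => i _; rewrite addnS.
rewrite exprS exprM sqrrN expr1n expr1n mul1r mulr1 !mulN1r mulNr.
by rewrite mulNr.
Qed.

Lemma Phi0 (G : R -> R) (s : R) d : Phi G 0 d s = derive1n d.+1 G s.
Proof. by []. Qed.

End identities.

Section upsilon.
Variables (R : realType) (mu nu : nat) (J : {linear 'rV[R]_nu -> 'M[R]_mu}).
Hypothesis hJ : heisenberg_type J.
Local Notation V := ('rV[R]_mu * 'rV[R]_nu * R)%type.
Local Notation S := (@carrier R mu nu).
Local Notation r := (rdist J).

Lemma Upsilon_top k (sigma : nat -> V -> R) p :
  Upsilon J k sigma (k.-1)./2 p = sigma (2 * (k.-1)./2 + 1)%N p.
Proof. by rewrite /Upsilon eqxx. Qed.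

(** Each term of the recursion has the same homogeneity as sigma_(2 j + 1). *)
Lemma Upsilon_le k : (0 < k)%N ->
  exists C : R, forall I (sigma : nat -> V -> R), size I = k ->
  radial_coefs J I sigma -> forall j, (j <= (k.-1)./2)%N ->
  forall p, S p -> p <> oneS R mu nu -> r p <= 1 ->
  `|Upsilon J k sigma j p| <= C * r p ^ (- k%:Z + (2 * j)%:Z + 1).
Proof.
move=> k0; have [Cs Cs0 Hs] := sigma_le hJ k.
suff H n : exists2 C : R, 0 <= C &
    forall I (sigma : nat -> V -> R), size I = k ->
    radial_coefs J I sigma -> forall j, (j < n)%N -> (j <= (k.-1)./2)%N ->
    forall p, S p -> p <> oneS R mu nu -> r p <= 1 ->
    `|Upsilon J k sigma j p| <= C * r p ^ (- k%:Z + (2 * j)%:Z + 1).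
  have [C _ HC] := H ((k.-1)./2).+1; exists C => I sigma sI Hr j jk.
  exact: (HC I sigma sI Hr).
elim: n => [|n [C C0 HC]]; first by exists 0.
exists (C + (Cs + n%:R * C)).
  by rewrite addr_ge0// addr_ge0// mulr_ge0.
move=> I sigma sI Hr j jn jk p Sp pn1 r1; have r0 := rdist_gt0 hJ Sp pn1.
have rn0 : r p != 0 by rewrite gt_eqF.
have ex i : 0 <= r p ^ i by apply: exprz_ge0; exact: ltW.
have [jn'|jn'] := ltnP j n.
  apply: (le_trans (HC I sigma sI Hr j jn' jk p Sp pn1 r1)).
  by apply: ler_wpM2r => //; rewrite lerDl addr_ge0// mulr_ge0.
have Ej : j = n by lia.
subst j.
have sb : `|sigma (2 * n + 1)%N p| <= Cs * r p ^ (- k%:Z + (2 * n)%:Z + 1).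
  have := Hs I sigma sI Hr p Sp pn1 r1 (2 * n + 1)%N.
  rewrite (_ : (2 * n + 1)%N%:Z - k%:Z = - k%:Z + (2 * n)%:Z + 1); last by lia.
  by apply; lia.
apply: (@le_trans _ _ ((Cs + n%:R * C) * r p ^ (- k%:Z + (2 * n)%:Z + 1)));
    last first.
  by apply: ler_wpM2r => //; rewrite lerDr.
have [nt|nt] := ltnP n (k.-1)./2; last first.
  have En : n = (k.-1)./2 by apply/eqP; rewrite eqn_leq jk.
  have -> : Upsilon J k sigma n p = sigma (2 * n + 1)%N p.
    by rewrite En Upsilon_top.
  by apply: (le_trans sb); apply: ler_wpM2r => //; rewrite lerDl mulr_ge0.
rewrite UpsilonE//.
apply: (le_trans (ler_normB _ _)); rewrite mulrDl; apply: lerD => //.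
apply: (le_trans (ler_norm_sum _ _ _)).
rewrite -mulrA mulr_natl -[X in _ *+ X](subn0 n) -sumr_const_nat.
apply: ler_sum_nat => l /andP[_ ln].
have -> : C * r p ^ (- k%:Z + (2 * n)%:Z + 1) =
    r p ^+ (2 * n - 2 * l) * (C * r p ^ (- k%:Z + (2 * l)%:Z + 1)).
  rewrite mulrCA -[r p ^+ _]/(r p ^ (2 * n - 2 * l)%N%:Z) -expfzDr//.
  by congr (_ * _ ^ _); lia.
rewrite normrM; apply: ler_pM => //; last first.
  by apply: (HC I sigma sI Hr) => //; lia.
rewrite ger0_norm; last by rewrite divr_ge0 ?exprn_ge0 ?ltW.
rewrite ler_pdivrMr ?ltr0n ?fact_gt0//.
apply: ler_peMr; first by apply: exprn_ge0; exact: ltW.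
by rewrite ler1n fact_gt0.
Qed.

(** The part of the expansion common to both parities of k: the remaining term
    h^(k) sigma_k for even k is left untouched by the elimination of sigma. *)
Lemma odd_even_identity k m (sigma : nat -> V -> R) (G : R -> R) p :
  m = (k.-1)./2 ->
  \sum_(0 <= j < m.+1) derive1n (2 * j + 1) G (r p) * sigma (2 * j + 1)%N p +
  \sum_(1 <= j < m.+1) derive1n (2 * j) G (r p) * sigma (2 * j)%N p =
  \sum_(0 <= j < m.+1)
     Phi G (2 * (m - j)) (2 * j) (r p) * Upsilon J k sigma j p +
  \sum_(1 <= j < m.+1) derive1n (2 * j) G (r p) * Xi J k sigma j p.
Proof.
move=> Em; set s := r p.
pose hh i := derive1n i G s; pose e i : R := s ^+ i / i`!%:R.
pose Y l := Upsilon J k sigma l p.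
have T := @sum_alternating_taylor R hh e Y m _.
rewrite big_nat_recr//= [in RHS]big_nat_recr//= subnn muln0 Phi0.
have -> : sigma (2 * m + 1)%N p = Y m by rewrite /Y Em Upsilon_top.
rewrite -/s (addn1 (2 * m)).
have -> : \sum_(0 <= j < m)
      Phi G (2 * (m - j)) (2 * j) s * Upsilon J k sigma j p =
    \sum_(0 <= l < m) alternating_taylor hh e (m - l) l * Y l.
  apply: eq_big_nat => l /andP[_ lm].
  by rewrite Phi_alternating_taylor// subn_gt0.
rewrite -T; last by rewrite /e expr0 fact0 divr1.
have -> : \sum_(0 <= j < m) derive1n (2 * j + 1) G s * sigma (2 * j + 1)%N p =
  \sum_(0 <= j < m) hh (2 * j + 1)%N *
    (Y j + \sum_(0 <= l < j) e (2 * j - 2 * l)%N * Y l).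
  apply: eq_big_nat => j /andP[_ jm]; congr (_ * _).
  by rewrite /Y UpsilonE -?Em// subrK.
have -> : \sum_(1 <= j < m.+1) derive1n (2 * j) G s * sigma (2 * j)%N p =
  \sum_(1 <= j < m.+1) derive1n (2 * j) G s * Xi J k sigma j p -
  \sum_(1 <= j < m.+1) hh (2 * j)%N *
    (\sum_(0 <= l < j) e (2 * j - 2 * l - 1)%N * Y l).
  by rewrite -sumrB; apply: eq_big_nat => j _; rewrite -mulrBr /Xi addrK.
rewrite -/(Y m); ring.
Qed.

End upsilon.

Theorem proposition4p5 (R : realType) (mu nu : nat)
    (J : {linear 'rV[R]_nu -> 'M[R]_mu})
    (hnu : (1 <= nu)%N) (hJ : heisenberg_type J)
    (k : nat) (hk : (1 <= k)%N) :
  (exists C : R, forall (I : k.-tuple 'I_(mu + nu).+1)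
      (sigma : nat -> 'rV[R]_mu * 'rV[R]_nu * R -> R),
    radial_coefs J I sigma ->
    forall j, (j <= (k - 1)./2)%N ->
    forall p, carrier p -> p <> oneS R mu nu -> rdist J p <= 1 ->
      `|Upsilon J k sigma j p| <= C * rdist J p ^ (- k%:Z + (2 * j)%:Z + 1)) /\
  (forall (I : k.-tuple 'I_(mu + nu).+1)
      (sigma : nat -> 'rV[R]_mu * 'rV[R]_nu * R -> R)
      (h : R -> 'rV[R]_mu * 'rV[R]_nu * R -> R) (H : R -> R -> R),
    radial_coefs J I sigma -> heat_kernel J h H ->
    forall t p, 0 < t -> carrier p -> p <> oneS R mu nu ->
      (odd k ->
        XJ J I (h t) p =
          \sum_(0 <= j < ((k - 1)./2).+1)
             Phi (H t) (k - 2 * j - 1) (2 * j) (rdist J p) *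
             Upsilon J k sigma j p
          + \sum_(1 <= j < ((k - 1)./2).+1)
             derive1n (2 * j) (H t) (rdist J p) * Xi J k sigma j p) /\
      (~~ odd k ->
        XJ J I (h t) p =
          \sum_(0 <= j < k./2)
             Phi (H t) (k - 2 * j - 2) (2 * j) (rdist J p) *
             Upsilon J k sigma j p
          + \sum_(1 <= j < k./2)
             derive1n (2 * j) (H t) (rdist J p) * Xi J k sigma j p
          + derive1n k (H t) (rdist J p) * sigma k p)).
Proof.
rewrite subn1; split.
  have [C HC] := Upsilon_le hJ hk; exists C => I sigma Hr.
  by apply: (HC I) => //; rewrite size_tuple.
move=> I sigma h H Hr [_ sm rad] t p t0 Sp pn1.
have E := Hr (h t) (H t) (sm t t0) (rad t t0) p Sp pn1.
rewrite size_tuple in E.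
set m := (k.-1)./2; have core := odd_even_identity J sigma (H t) p (erefl m).
split=> ok.
  have Ek : k = (2 * m).+1.
    rewrite /m; have := odd_double_half k.-1.
    by move: hk ok; case: (k) => //= n _; lia.
  rewrite E {1}Ek big_nat_odd_even core; congr (_ + _).
  by apply: eq_big_nat => j /andP[_ jm]; congr (Phi _ _ _ _ * _); lia.
have Ek : k = (2 * m).+2.
  rewrite /m; have := odd_double_half k.-1.
  by move: hk ok; case: (k) => //= n _; lia.
have -> : k./2 = m.+1 by lia.
rewrite E big_nat_recr//= {1}Ek big_nat_odd_even core; congr (_ + _ + _).
by apply: eq_big_nat => j /andP[_ jm]; congr (Phi _ _ _ _ * _); lia.
Qed.
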